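(* Let $p$ be a prime and let $K$ be a field complete with respect to a non-Archimedean absolute value $|\cdot|$ with $|p|=1/p$. Let $S=K\langle x_1,\ldots,x_d\rangle$ be the Tate algebra over $K$. Suppose $\sigma:S\to S$ is a $K$-algebra automorphism such that $|\sigma(x_i)-x_i|<p^{-c}$ for $i=1,\ldots,d$, for some real $c>1/(p-1)$, where $|\cdot|$ on $S$ is the Gauss norm. If $M$ and $N$ are finitely generated $S$-modules and $i\ge 1$, then the set of $n\in\mathbb{Z}$ for which $\mathrm{Tor}_i^S((\sigma^n)^*M,N)\neq 0$ is, up to addition and removal of a finite set, a finite union of arithmetic progressions of difference $p^r$ for some $r\ge 0$.
   Context: The Tate algebra $K\langle x_1,\ldots,x_d\rangle$ is the ring of power series $\sum_\alpha a_\alpha x^\alpha$ over $K$ with $|a_\alpha|\to 0$; its Gauss norm is $|\sum a_\alpha x^\alpha|=\max_\alpha|a_\alpha|$. For a ring automorphism $\tau$ of $S$ and an $S$-module $M$, $\tau^*M=S\otimes_{\tau,S}M$ is the base change of $M$ along $\tau$; concretely, if $M=S^e/\langle r_1,\ldots,r_m\rangle$ then $\tau^*M=S^e/\langle\tau(r_1),\ldots,\tau(r_m)\rangle$ (with $\tau$ applied coordinatewise). *)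

(* Defs.v *)
From HB Require Import structures.
From mathcomp Require Import all_boot all_order all_algebra.
From mathcomp Require Import reals exp.
Set Implicit Arguments. Unset Strict Implicit. Unset Printing Implicit Defensive.
Import Order.TTheory GRing.Theory Num.Theory.
Local Open Scope ring_scope.

Section Defs.
Variable R : realType.

Definition nonarch_complete_abs (K : fieldType) (abs : K -> R) : Prop :=
  [/\ (forall x, 0 <= abs x),
      (forall x, abs x = 0 <-> x = 0),
      (forall x y, abs (x * y) = abs x * abs y),
      (forall x y, abs (x + y) <= Num.max (abs x) (abs y)) &
      (forall u : nat -> K,
          (forall e : R, 0 < e -> exists N, forall m n, (N <= m)%N -> (N <= n)%N ->
               abs (u m - u n) < e) ->
          exists l, forall e : R, 0 < e -> exists N, forall n, (N <= n)%N ->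
               abs (u n - l) < e)].

Definition mon (d : nat) := {ffun 'I_d -> nat}.
Definition mdeg d (a : mon d) : nat := (\sum_(i < d) a i)%N.
Definition mon0 d : mon d := [ffun => 0%N].
Definition mon_unit d (i : 'I_d) : mon d := [ffun j => nat_of_bool (j == i)].
Definition mon_of d B (a : {ffun 'I_d -> 'I_B}) : mon d := [ffun i => nat_of_ord (a i)].
Definition msub d (g a : mon d) : mon d := [ffun i => (g i - a i)%N].

(* Cauchy product coefficient: sum_{alpha + beta = gamma} F alpha * G beta
   (alpha ranges over alpha <= gamma, encoded with bounded ordinals) *)
Definition conv (K : fieldType) d (g : mon d) (F G : mon d -> K) : K :=
  \sum_(a : {ffun 'I_d -> 'I_(mdeg g).+1} | [forall i, (a i <= g i)%N])
     F (mon_of a) * G (msub g (mon_of a)).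

Definition null_family (K : fieldType) (abs : K -> R) d (a : mon d -> K) : Prop :=
  forall e : R, 0 < e -> exists N, forall al : mon d, (N <= mdeg al)%N -> abs (a al) < e.

(* S, with distinguished elements x_1..x_d and coefficient functionals coef,
   is (identified with) the Tate algebra K<x_1,...,x_d>: f <-> sum_al (coef al f) x^al
   is a K-algebra isomorphism onto the power series with coefficients -> 0. *)
Definition is_Tate_algebra (K : fieldType) (abs : K -> R) d (S : comAlgType K)
    (x : 'I_d -> S) (coef : mon d -> S -> K) : Prop :=
  (forall al (a : K) (f g : S), coef al (a *: f + g) = a * coef al f + coef al g) /\
  (forall f : S, (forall al, coef al f = 0) -> f = 0) /\
  (forall f : S, null_family abs (fun al => coef al f)) /\
  (forall a : mon d -> K, null_family abs a -> exists f : S, forall al, coef al f = a al) /\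
  (forall (f g : S) gm, coef gm (f * g) = conv gm (coef^~ f) (coef^~ g)) /\
  (forall gm, coef gm 1 = (gm == mon0 d)%:R) /\
  (forall i gm, coef gm (x i) = (gm == mon_unit i)%:R).

(* Gauss norm: |f| = max_al |coef al f|  (the max exists since coef -> 0) *)
Definition is_gauss_norm (K : fieldType) (abs : K -> R) d (S : comAlgType K)
    (coef : mon d -> S -> K) (f : S) (r : R) : Prop :=
  (forall al, abs (coef al f) <= r) /\ exists al, abs (coef al f) = r.

Definition is_Kalg_aut (K : fieldType) (S : comAlgType K) (s sinv : S -> S) : Prop :=
  (forall f g, s (f + g) = s f + s g) /\
  (forall f g, s (f * g) = s f * s g) /\
  s 1 = 1 /\
  (forall (a : K) f, s (a *: f) = a *: s f) /\
  cancel s sinv /\ cancel sinv s.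

Definition zpow_fun (T : Type) (s sinv : T -> T) (n : int) : T -> T :=
  match n with
  | Posz k => iter k s
  | Negz k => iter k.+1 sinv
  end.

(* A finitely generated S-module is presented as S^e / U for a submodule U of S^e
   (row vectors). *)
Definition is_submodule (S : comNzRingType) e (U : 'rV[S]_e -> Prop) : Prop :=
  [/\ U 0, (forall u v, U u -> U v -> U (u + v)) & (forall (a : S) u, U u -> U (a *: u))].

(* base change along a ring automorphism t: t^* (S^e/U) = S^e / t(U) *)
Definition basechange_sub (S : comNzRingType) e (t : S -> S) (U : 'rV[S]_e -> Prop)
  : 'rV[S]_e -> Prop := fun v => exists2 u, U u & v = map_mx t u.

Definition rows_in (S : comNzRingType) m f (U : 'rV[S]_f -> Prop) (X : 'M[S]_(m, f)) : Prop :=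
  forall j, U (row j X).

Definition free_resolution (S : comNzRingType) e (U : 'rV[S]_e -> Prop)
    (r : nat -> nat) (D : forall k, 'M[S]_(r k.+1, r k)) : Prop :=
  exists h : r 0%N = e,
  [/\ (forall v : 'rV[S]_e, U v <-> exists w : 'rV[S]_(r 1%N), v = castmx (erefl, h) (w *m D 0%N)) &
      (forall k (v : 'rV[S]_(r k.+1)),
          v *m D k = 0 <-> exists w : 'rV[S]_(r k.+2), v = w *m D k.+1)].

(* cycles of F . (x) N, where N = S^f / V and F_k (x) N = N^(r k) is represented by
   'M_(r k, f) modulo rows in V; the differential is X |-> (D k)^T *m X *)
Definition tor_cycle (S : comNzRingType) f (V : 'rV[S]_f -> Prop)
    (r : nat -> nat) (D : forall k, 'M[S]_(r k.+1, r k)) (k : nat) : 'M[S]_(r k, f) -> Prop :=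
  match k return 'M[S]_(r k, f) -> Prop with
  | 0%N => fun _ => True
  | k'.+1 => fun X => rows_in V ((D k')^T *m X)
  end.

Definition tor_boundary (S : comNzRingType) f (V : 'rV[S]_f -> Prop)
    (r : nat -> nat) (D : forall k, 'M[S]_(r k.+1, r k)) (k : nat) (X : 'M[S]_(r k, f)) : Prop :=
  exists Y : 'M[S]_(r k.+1, f), rows_in V (X - (D k)^T *m Y).

Definition Tor_nonzero (S : comNzRingType) (i : nat) e (U : 'rV[S]_e -> Prop)
    f (V : 'rV[S]_f -> Prop) : Prop :=
  exists (r : nat -> nat) (D : forall k, 'M[S]_(r k.+1, r k)),
    free_resolution U D /\
    exists X : 'M[S]_(r i, f), tor_cycle V D X /\ ~ tor_boundary V D X.

Definition ae_union_of_APs (q : nat) (P : int -> Prop) : Prop :=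
  exists (A E : seq int), forall n : int, n \notin E ->
    (P n <-> exists2 a, a \in A & (n = a %[mod q%:Z])%Z).

End Defs.

(* Main.v *)
Require Import Defs.
From HB Require Import structures.
From mathcomp Require Import all_boot all_order all_algebra.
From mathcomp Require Import reals exp.
From mathcomp Require Import boolp zify ring lra.
Set Implicit Arguments. Unset Strict Implicit. Unset Printing Implicit Defensive.
Import Order.TTheory GRing.Theory Num.Theory.
Local Open Scope ring_scope.

(** Bounded division by a Groebner basis (leading monomials, Dickson's lemma,
    completeness) holds in every Tate algebra: each submodule of a free module
    has generators such that its elements are combinations of them with
    coefficients of no larger norm.

    With Delta = sigma - 1, Newton's series sum_k binom(z, k) Delta^k f
    converges to an element of A = S<z> whose value at each integer n is
    sigma^n f, because |Delta^k f| <= p^(-ck) |f| and c > 1/(p-1).  A free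
    resolution of M thus becomes a family of complexes over A.  Let T be the
    homology over A.  For all but finitely many n, the Tor module at n is
    T/(z-n)T; by the determinant trick it vanishes iff some element of
    I = Ann T takes the value 1 at z = n.

    Fix a in the closure of Z in K, let I' be the (z-a)-saturation of I and J
    its image at z = a.  If J contains 1, so does the image of I at every
    nearby b <> a.  Otherwise bounded division in J lets one lift every element
    of the image of I' at a nearby b with a uniform bound, so 1 in that image
    would force an element of J close to 1, hence a unit.  So the vanishing of
    Tor is constant on punctured p-adic neighbourhoods, and compactness of the
    p-adic integers gives the arithmetic progressions. *)

(** * Lexicographic order and Dickson's lemma *)

(** The set of n is not the zero set of an analytic function of n, so Strassman's finiteness of
    zeros does not apply: the fibre of T vanishes when the image of I at n is all of S, a condition
    on a whole polydisc. For d = 1 and I generated by z - p x, the image at n is the unit ideal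
    exactly when p does not divide n; so genuine progressions occur. Being the unit ideal is stable
    under small perturbations, but failing to be it must be stable as well. For that, lifts from J
    have to be bounded independently of b, a bound that Noetherianity alone does not give; this is
    what bounded division is for. Saturating at a is harmless at b <> a, where z - a takes the
    invertible value b - a. The point a itself is lost, hence the punctured neighbourhoods and one
    source of exceptional integers. The threshold 1/(p-1) comes from |k!| >= p^(-k/(p-1)), which
    controls the denominators of the binomials. Only sigma, not its inverse, is assumed close to the
    identity, so negative n are reached from positive ones by p-adic continuity. *)

Section Coordinates.
Variable T : Type.
Implicit Types (cs : seq (T -> nat)) (a b : T).

Fixpoint lexlt cs a b : bool :=
  if cs is c :: cs' then (c a < c b)%N || (c a == c b) && lexlt cs' a b
  else false.

Lemma lexlt_irr cs a : lexlt cs a a = false.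
Proof. by elim: cs => //= c cs ->; rewrite ltnn andbF. Qed.

Lemma lexlt_trans cs a b c : lexlt cs a b -> lexlt cs b c -> lexlt cs a c.
Proof.
elim: cs => //= f cs IH /orP[ab|/andP[/eqP ab lab]] /orP[bc|/andP[/eqP bc lbc]].
- by rewrite (ltn_trans ab bc).
- by rewrite -bc ab.
- by rewrite ab bc.
- by rewrite ab bc eqxx IH ?orbT.
Qed.

Lemma lexlt_total cs a b :
  ~~ lexlt cs a b -> ~~ lexlt cs b a -> all (fun c => c a == c b) cs.
Proof.
elim: cs => //= f cs IH; rewrite !negb_or => /andP[ab nab] /andP[ba nba].
have E : f a = f b by case: ltngtP ab ba.
move: nab nba; rewrite E eqxx /= => nab nba; exact: IH.
Qed.

(** The first coordinate can drop only finitely often, and while it stays fixed the remaining ones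
    descend: an induction on its bound [n] around the well-founded induction for the tail. *)
Lemma lexlt_wf cs : well_founded (fun a b => lexlt cs a b).
Proof.
elim: cs => [|f cs IH] a; first by apply: Acc_intro => b /notF.
have [n] := ubnP (f a); elim: n a => [a|n IHn a]; first by rewrite ltn0 => /notF.
elim/(well_founded_ind IH): a => a IHa le_n; apply: Acc_intro => b /= /orP[lt_ba|/andP[/eqP E l]].
  by apply: IHn; apply: leq_trans lt_ba _.
by apply: IHa; rewrite ?E.
Qed.

Lemma lexlt_mono cs (g : T -> T) :
  (forall c a b, List.In c cs -> (c a < c b)%N -> (c (g a) < c (g b))%N) ->
  (forall c a b, List.In c cs -> c a = c b -> c (g a) = c (g b)) ->
  forall a b, lexlt cs a b -> lexlt cs (g a) (g b).
Proof.
elim: cs => //= c cs IH Hlt Heq a b /orP[ab|/andP[/eqP ab lab]].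
  by rewrite Hlt //; left.
rewrite (Heq c a b) ?eqxx //=; last by left.
rewrite IH ?orbT // => c' a' b' c'cs; [apply: Hlt|apply: Heq]; by right.
Qed.

(** Used on infinite index sets: only finitely many coefficients exceed a given positive size, so
    [P] lives on a list and a largest index exists. *)
Lemma maximal_in_seq (P : T -> Prop) (lt : T -> T -> Prop) (L : seq T) :
  (forall a, ~ lt a a) -> (forall a b c, lt a b -> lt b c -> lt a c) ->
  (forall a, P a -> List.In a L) -> (exists a, P a) ->
  exists a, P a /\ forall b, P b -> ~ lt a b.
Proof.
move=> irr tr; elim: L P => [|y L IH] P PL [x Px]; first by case: (PL x Px).
have [[a [Pa nay]]|none] := EM (exists a, P a /\ a <> y); last first.
  have allE b : P b -> b = y by move=> Pb; apply: contrapT => nby; apply: none; exists b.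
  by exists y; split=> [|b /allE ->]; rewrite -?(allE x Px).
have [|a' [[Pa' na'y] a'M]] := IH (fun a => P a /\ a <> y) _ (ex_intro _ a (conj Pa nay)).
  by move=> b [/PL /= [->|]].
have [[Py lt_ay]|nlt] := EM (P y /\ lt a' y).
  exists y; split=> // b Pb lt_yb; apply: (a'M b); last exact: tr lt_yb.
  by split=> // E; apply: (irr y); rewrite -{2}E.
exists a'; split=> // b Pb lt_a'b.
have [E|nby] := EM (b = y); first by apply: nlt; rewrite -E.
exact: (a'M b).
Qed.

Definition coord_le cs a b := forall c, List.In c cs -> (c a <= c b)%N.

(** Every tail of [v] attains its minimum, the values being naturals; jumping to minima of later and
    later tails gives the subsequence. *)
Lemma nondecreasing_subseq (v : nat -> nat) :
  exists phi : nat -> nat, (forall i, (phi i < phi i.+1)%N) /\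
    forall i j, (i <= j)%N -> (v (phi i) <= v (phi j))%N.
Proof.
have /choice[nxt Hnxt] (k : nat) : exists n, (k <= n)%N /\ forall m, (k <= m)%N -> (v n <= v m)%N.
  suff H n k' : (v k' < n)%N -> (k <= k')%N ->
      exists n, (k <= n)%N /\ forall m, (k <= m)%N -> (v n <= v m)%N.
    exact: (H _ k (ltnSn _) (leqnn k)).
  elim: n k' => // n IH k' le_n le_kk'.
  have [[m [le_km lt_m]]|none] := EM (exists m, (k <= m)%N /\ (v m < v k')%N).
    by apply: (IH m) => //; apply: leq_trans lt_m _.
  exists k'; split=> // m le_km; rewrite leqNgt; apply/negP => lt_m.
  by apply: none; exists m.
pose phi := fix phi i := if i is i'.+1 then nxt (phi i').+1 else nxt 0%N.
have phiS i : (phi i < phi i.+1)%N by have [] := Hnxt (phi i).+1.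
exists phi; split=> // i j le_ij; case: i le_ij => [|i] le_ij /=.
  by have [_] := Hnxt 0%N; apply.
have [_] := Hnxt (phi i).+1; apply.
elim: j le_ij => // j IH; rewrite leq_eqVlt => /orP[/eqP <- //|lt_ij].
by apply: leq_trans (IH lt_ij) _; apply: ltnW.
Qed.

Lemma coord_le_subseq cs (u : nat -> T) :
  exists phi : nat -> nat, (forall i, (phi i < phi i.+1)%N) /\
    forall i j, (i <= j)%N -> coord_le cs (u (phi i)) (u (phi j)).
Proof.
elim: cs => [|c cs [phi [phiS phiM]]]; first by exists id; split=> // ? ? _ ?.
have [psi [psiS psiM]] := nondecreasing_subseq (fun i => c (u (phi i))).
have mono (f : nat -> nat) : (forall i, (f i < f i.+1)%N) -> forall i j, (i < j)%N -> (f i < f j)%N.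
  move=> fS i; elim=> // j IH; rewrite ltnS leq_eqVlt => /orP[/eqP -> //|/IH lt].
  exact: ltn_trans lt (fS j).
exists (phi \o psi); split=> [i|i j le_ij c' /= [<-|c'cs]]; first exact: (mono phi phiS).
  exact: psiM.
apply: phiM => //; move: le_ij; rewrite leq_eqVlt => /orP[/eqP -> //|/(mono _ psiS)/ltnW //].
Qed.

(* Dickson's lemma *)
Lemma finite_coord_basis cs (P : T -> Prop) :
  exists L : seq T, (forall a, List.In a L -> P a) /\
    forall b, P b -> exists2 a, List.In a L & coord_le cs a b.
Proof.
apply: contrapT => noL.
have /choice[nxt Hnxt] (L : seq T) : exists b, (forall a, List.In a L -> P a) ->
    P b /\ forall a, List.In a L -> ~ coord_le cs a b.
  have [LP|nLP] := EM (forall a, List.In a L -> P a); last first.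
    have [[b]|nP] := EM (exists b, P b); first by exists b => /nLP.
    case: noL; exists [::]; split=> // b Pb; case: nP; by exists b.
  apply: contrapT => nob; apply: noL; exists L; split=> // b Pb.
  apply: contrapT => nole; apply: nob; exists b => _; split=> // a aL le_ab.
  by apply: nole; exists a.
(* A bad sequence: [nxt (Ls k)] lies above no earlier term, whereas [coord_le_subseq] produces two
   comparable ones. *)
pose Ls := fix Ls k := if k is k'.+1 then nxt (Ls k') :: Ls k' else [::].
have LsP k : forall a, List.In a (Ls k) -> P a.
  by elim: k => //= k IH a [<-|/IH //]; have [] := Hnxt _ IH.
have LsI i j : (i < j)%N -> List.In (nxt (Ls i)) (Ls j).
  elim: j => // j IH; rewrite ltnS leq_eqVlt => /orP[/eqP ->|/IH]; first by left.
  by right.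
have [phi [phiS phiM]] := coord_le_subseq cs (fun k => nxt (Ls k)).
have [_ /(_ _ (LsI _ _ (phiS 0%N)))] := Hnxt _ (LsP (phi 1%N)); apply.
exact: phiM.
Qed.

End Coordinates.

(** * Ultrametric absolute values and Tate algebras *)

Lemma geometric_small (R : realType) (q r e : R) : 0 <= q < 1 -> 0 < e ->
  exists N, forall k, (N <= k)%N -> r * q ^+ k <= e.
Proof.
move=> /andP[q0 q1] e0; pose h := 1 - q.
have h0 : 0 < h by rewrite subr_gt0.
have bern k : q ^+ k * (1 + k%:R * h) <= 1.
  elim: k => [|k IH]; first by rewrite expr0 mul0r addr0 mulr1.
  apply: le_trans IH; rewrite exprSr -mulrA.
  apply: ler_wpM2l; first exact: exprn_ge0.
  rewrite -subr_ge0 /h -natr1.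
  have -> : 1 + k%:R * (1 - q) - q * (1 + (k%:R + 1) * (1 - q)) = (k%:R + 1) * (1 - q) ^+ 2 by ring.
  by rewrite mulr_ge0 ?sqr_ge0 // addr_ge0.
have he0 : 0 < h * e by exact: mulr_gt0.
exists (Num.bound (`|r| / (h * e))) => k le_k.
have k1 : `|r| / (h * e) <= k%:R.
  apply: le_trans (ltW (archi_boundP _)) _; last by rewrite ler_nat.
  by rewrite divr_ge0 // ltW.
have qk0 : 0 <= q ^+ k by exact: exprn_ge0.
have H1 : `|r| * q ^+ k <= k%:R * (h * e) * q ^+ k.
  by apply: ler_wpM2r => //; rewrite -ler_pdivrMr.
have H2 : q ^+ k * (k%:R * h) <= 1 by apply: le_trans (bern k); apply: ler_wpM2l => //; rewrite lerDr.
apply: le_trans (_ : `|r| * q ^+ k <= _); first by apply: ler_wpM2r => //; exact: ler_norm.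
apply: le_trans H1 _; have -> : k%:R * (h * e) * q ^+ k = q ^+ k * (k%:R * h) * e by ring.
by rewrite -[leRHS]mul1r; apply: ler_wpM2r => //; apply: ltW.
Qed.

Section Ultrametric.
Variables (R : realType) (K : fieldType) (abs : K -> R).
Hypothesis Habs : nonarch_complete_abs abs.

Lemma abs_ge0 x : 0 <= abs x. Proof. by case: Habs. Qed.
Lemma abs_eq0 x : abs x = 0 <-> x = 0. Proof. by case: Habs => _ H. Qed.
Lemma absM x y : abs (x * y) = abs x * abs y. Proof. by case: Habs. Qed.
Lemma abs0 : abs 0 = 0. Proof. exact/abs_eq0. Qed.

Lemma abs_gt0 x : x != 0 -> 0 < abs x.
Proof. by rewrite lt_def abs_ge0 andbT; apply: contra_neq => /abs_eq0. Qed.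

Lemma abs1 : abs 1 = 1.
Proof.
have n0 : abs 1 != 0 by apply: lt0r_neq0; apply: abs_gt0; exact: oner_neq0.
by apply: (mulfI n0); rewrite -absM !mulr1.
Qed.

Lemma absN x : abs (- x) = abs x.
Proof.
suff E : abs (-1) = 1 by rewrite -mulN1r absM E mul1r.
have : abs (-1) ^+ 2 == 1 by rewrite expr2 -absM mulrNN mulr1 abs1.
rewrite sqrf_eq1 => /orP[/eqP //|/eqP E]; have := abs_ge0 (-1).
by rewrite E ler0N1.
Qed.

Lemma absX x n : abs (x ^+ n) = abs x ^+ n.
Proof. by elim: n => [|n IH]; rewrite ?expr0 ?abs1 // !exprS absM IH. Qed.

Lemma absV x : abs x^-1 = (abs x)^-1.
Proof.
have [->|x0] := eqVneq x 0; first by rewrite invr0 abs0 invr0.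
have a0 : abs x != 0 by apply: lt0r_neq0; exact: abs_gt0.
by apply: (mulfI a0); rewrite -absM !mulfV // abs1.
Qed.

Lemma abs_leD r x y : abs x <= r -> abs y <= r -> abs (x + y) <= r.
Proof.
case: Habs => _ _ _ H _ xr yr; apply: le_trans (H x y) _.
by rewrite ge_max xr yr.
Qed.

Lemma abs_ltD r x y : abs x < r -> abs y < r -> abs (x + y) < r.
Proof.
case: Habs => _ _ _ H _ xr yr; apply: le_lt_trans (H x y) _.
by rewrite gt_max xr yr.
Qed.

Lemma abs_leB r x y : abs x <= r -> abs y <= r -> abs (x - y) <= r.
Proof. by move=> xr yr; apply: abs_leD => //; rewrite absN. Qed.

Lemma abs_le_sum r (J : Type) (s : seq J) (P : pred J) (F : J -> K) :
  0 <= r -> (forall i, P i -> abs (F i) <= r) -> abs (\sum_(i <- s | P i) F i) <= r.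
Proof.
move=> r0 H; elim/big_ind: _ => //; first by rewrite abs0.
by move=> *; apply: abs_leD.
Qed.

Lemma abs_lt_sum r (J : Type) (s : seq J) (P : pred J) (F : J -> K) :
  0 < r -> (forall i, P i -> abs (F i) < r) -> abs (\sum_(i <- s | P i) F i) < r.
Proof.
move=> r0 H; elim/big_ind: _ => //; first by rewrite abs0.
by move=> *; apply: abs_ltD.
Qed.

Lemma abs_small_eq0 x : (forall e, 0 < e -> abs x <= e) -> x = 0.
Proof.
move=> H; apply/eqP; apply: contraT => /abs_gt0 x0.
have := H (abs x / 2) (divr_gt0 x0 (ltr0n _ 2)); lra.
Qed.

Definition null_seq (u : nat -> K) :=
  forall e, 0 < e -> exists N, forall k, (N <= k)%N -> abs (u k) <= e.

(** In an ultrametric field terms tending to 0 already make a series converge, and no tail exceeds a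
    bound on its terms. The estimate for all [N] and [r] at once is what later limits quote. *)
Lemma null_sum (u : nat -> K) : null_seq u ->
  exists l, forall N r, (forall k, (N <= k)%N -> abs (u k) <= r) ->
    abs (l - \sum_(k < N) u k) <= r.
Proof.
move=> nu; pose s n := \sum_(k < n) u k.
have tail N r n : (forall k, (N <= k)%N -> abs (u k) <= r) -> (N <= n)%N -> abs (s n - s N) <= r.
  move=> H le_Nn; have r0 : 0 <= r by apply: le_trans (abs_ge0 _) (H N _).
  rewrite /s -!(big_mkord xpredT u) (big_cat_nat (leq0n N) le_Nn) /= addrAC subrr add0r.
  by rewrite big_seq_cond; apply: abs_le_sum => // i; rewrite mem_index_iota andbT => /andP[/H].
have [_ _ _ _ /(_ s)[]] := Habs.
  move=> e e0; have [N HN] := nu (e / 2) (divr_gt0 e0 (ltr0n _ 2)).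
  exists N => m n Nm Nn; apply: (@le_lt_trans _ _ (e / 2)); last by lra.
  rewrite -[s m - s n](subrKA (s N)) -[s N - s n]opprB.
  by apply: abs_leB; apply: tail.
move=> l Hl; exists l => N r H; rewrite leNgt; apply/negP => lt_r.
have r0 : 0 <= r by apply: le_trans (abs_ge0 _) (H N _).
have [M HM] := Hl _ (le_lt_trans r0 lt_r).
have := HM (maxn M N) (leq_maxl _ _); rewrite -absN opprB => lt1.
have lt2 := le_lt_trans (tail _ _ _ H (leq_maxr M N)) lt_r.
by have := abs_ltD lt1 lt2; rewrite subrKA ltxx.
Qed.

Section Tatelike.
Variable I : finType.
Local Notation mono := {ffun I -> nat}.
Definition mnle (b g : mono) := [forall i, (b i <= g i)%N].
Definition mnsub (g b : mono) : mono := [ffun i => (g i - b i)%N].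
Definition mnadd (g b : mono) : mono := [ffun i => (g i + b i)%N].

(* What division needs of a Tate algebra in the variables [I]; it is shared by S
   (with [I := 'I_d]) and S<z> (with [I := option 'I_d]). *)
Record tatelike (A : comNzRingType) (cf : mono -> A -> K) (term : K -> mono -> A) : Prop := Tatelike {
  tl_add : forall al f g, cf al (f + g) = cf al f + cf al g;
  tl_inj : forall f, (forall al, cf al f = 0) -> f = 0;
  tl_null : forall f e, 0 < e -> exists N, forall al : mono, (N <= \sum_i al i)%N -> abs (cf al f) <= e;
  tl_surj : forall a : mono -> K,
    (forall e, 0 < e -> exists N, forall al : mono, (N <= \sum_i al i)%N -> abs (a al) <= e) ->
    exists f, forall al, cf al f = a al;
  tl_mul : forall f g r s, (forall al, abs (cf al f) <= r) -> (forall al, abs (cf al g) <= s) ->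
    forall al, abs (cf al (f * g)) <= r * s;
  tl_one : forall al, abs (cf al 1) <= 1;
  tl_term : forall a b f al,
    cf al (term a b * f) = if mnle b al then a * cf (mnsub al b) f else 0 }.

Lemma finite_degree_lt N : exists L : seq mono, forall al : mono, (\sum_i al i < N)%N -> al \in L.
Proof.
exists [seq [ffun i => val (a i)] | a : {ffun I -> 'I_N}] => al lt_al.
have lt i : (al i < N)%N by apply: leq_ltn_trans lt_al; rewrite (bigD1 i) //= leq_addr.
apply/imageP; exists [ffun i => Ordinal (lt i)] => //.
by apply/ffunP => i; rewrite !ffunE.
Qed.

Variables (A : comNzRingType) (cf : mono -> A -> K) (term : K -> mono -> A).
Hypothesis HA : tatelike cf term.

(* The Gauss norm of [f] is at most [r]. *)
Definition nle (f : A) (r : R) := forall al, abs (cf al f) <= r.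

Lemma cf0 al : cf al 0 = 0.
Proof. by apply: (addrI (cf al 0)); rewrite -(tl_add HA) !addr0. Qed.

Lemma cfN al f : cf al (- f) = - cf al f.
Proof. by apply: (addrI (cf al f)); rewrite -(tl_add HA) !subrr cf0. Qed.

Lemma cfB al f g : cf al (f - g) = cf al f - cf al g.
Proof. by rewrite (tl_add HA) cfN. Qed.

Lemma cf_sum al (J : Type) (s : seq J) (P : pred J) F :
  cf al (\sum_(i <- s | P i) F i) = \sum_(i <- s | P i) cf al (F i).
Proof. exact: (big_morph (cf al) (tl_add HA al) (cf0 al)). Qed.

Lemma nle_ge0 f r : nle f r -> 0 <= r.
Proof. by move/(_ [ffun => 0%N]); apply: le_trans (abs_ge0 _). Qed.
Lemma nle0 r : 0 <= r -> nle 0 r. Proof. by move=> r0 al; rewrite cf0 abs0. Qed.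
Lemma nle_trans f r s : r <= s -> nle f r -> nle f s.
Proof. by move=> rs H al; apply: le_trans (H al) rs. Qed.
Lemma nleD f g r : nle f r -> nle g r -> nle (f + g) r.
Proof. by move=> fr gr al; rewrite (tl_add HA); apply: abs_leD. Qed.
Lemma nleN f r : nle f r -> nle (- f) r.
Proof. by move=> fr al; rewrite cfN absN. Qed.
Lemma nleB f g r : nle f r -> nle g r -> nle (f - g) r.
Proof. by move=> fr gr; apply: nleD => //; apply: nleN. Qed.
Lemma nleM f g r s : nle f r -> nle g s -> nle (f * g) (r * s).
Proof. exact: (tl_mul HA). Qed.
Lemma nle_sum (J : Type) (s : seq J) (P : pred J) F r :
  0 <= r -> (forall i, P i -> nle (F i) r) -> nle (\sum_(i <- s | P i) F i) r.
Proof.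
move=> r0 H; elim/big_ind: _ => //; first exact: nle0.
by move=> *; apply: nleD.
Qed.

Lemma nle_small_eq0 f : (forall e, 0 < e -> nle f e) -> f = 0.
Proof.
by move=> H; apply: (tl_inj HA) => al; apply: abs_small_eq0 => e e0; apply: H.
Qed.

Lemma nle_bounded f : exists2 r, 0 < r & nle f r.
Proof.
have [N HN] := tl_null HA f (@ltr01 R).
have [L HL] := finite_degree_lt N.
exists (1 + \sum_(al <- L) abs (cf al f)) => [|al].
  by apply: ltr_pwDl => //; apply: sumr_ge0 => *; apply: abs_ge0.
have [/HN le1|/HL alL] := leqP N (\sum_i al i).
  by apply: le_trans le1 _; rewrite lerDl; apply: sumr_ge0 => *; apply: abs_ge0.
rewrite (big_rem al) //= addrCA lerDl.
by apply: addr_ge0 => //; apply: sumr_ge0 => *; apply: abs_ge0.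
Qed.

Lemma tl_sum (s : nat -> A) :
  (forall e, 0 < e -> exists N, forall k, (N <= k)%N -> nle (s k) e) ->
  exists l, forall N r, (forall k, (N <= k)%N -> nle (s k) r) -> nle (l - \sum_(k < N) s k) r.
Proof.
move=> ns.
have /choice[l Hl] al : exists l, forall N r, (forall k, (N <= k)%N -> abs (cf al (s k)) <= r) ->
    abs (l - \sum_(k < N) cf al (s k)) <= r.
  by apply: null_sum => e /ns[N HN]; exists N => k /HN.
(* The coefficientwise limits are a null family: up to [e] they agree with the coefficients of one
   partial sum, an element of [A]. *)
have [f Hf] : exists f, forall al, cf al f = l al.
  apply: (tl_surj HA) => e e0; have [N HN] := ns e e0.
  have [M HM] := tl_null HA (\sum_(k < N) s k) e0.
  exists M => al /HM H; rewrite -[l al](subrK (\sum_(k < N) cf al (s k))).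
  by apply: abs_leD; [apply: Hl => k /HN|rewrite -cf_sum].
by exists f => N r H al; rewrite cfB cf_sum Hf; apply: Hl => k /H.
Qed.

Lemma nle_geometric_null (s : nat -> A) r q : 0 <= q < 1 -> (forall k, nle (s k) (r * q ^+ k)) ->
  forall e, 0 < e -> exists N, forall k, (N <= k)%N -> nle (s k) e.
Proof.
move=> q01 H e /(geometric_small r q01)[N HN]; exists N => k /HN le_e.
exact: nle_trans le_e (H k).
Qed.
End Tatelike.
End Ultrametric.

(** * Bounded division *)

Definition submodule (A : comNzRingType) (M : lmodType A) (U : M -> Prop) : Prop :=
  [/\ U 0, (forall u v, U u -> U v -> U (u + v)) & (forall (a : A) u, U u -> U (a *: u))].

Section Submodule.
Variables (A : comNzRingType) (M : lmodType A) (U : M -> Prop).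
Hypothesis HU : submodule U.
Lemma submod_sum (J : Type) (s : seq J) (P : pred J) F :
  (forall i, P i -> U (F i)) -> U (\sum_(i <- s | P i) F i).
Proof. by case: HU => U0 UD _ H; elim/big_ind: _. Qed.
Lemma submodB u v : U u -> U v -> U (u - v).
Proof. by case: HU => _ UD UZ Uu Uv; rewrite -scaleN1r; apply: UD => //; apply: UZ. Qed.
End Submodule.

Lemma In_mem (T : eqType) (x : T) s : List.In x s <-> x \in s.
Proof.
elim: s => //= y s IH; rewrite inE; split=> [[->|/IH ->]|/orP[/eqP ->|/IH]].
- by rewrite eqxx.
- by rewrite orbT.
- by left.
- by right.
Qed.

Section BoundedDivision.
Variables (R : realType) (K : fieldType) (abs : K -> R).
Hypothesis Habs : nonarch_complete_abs abs.
Variable I : finType.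
Local Notation mono := {ffun I -> nat}.
Variables (A : comNzRingType) (cf : mono -> A -> K) (term : K -> mono -> A).
Hypothesis HA : tatelike abs cf term.
Variables m n : nat.
Local Notation V := 'M[A]_(m, n).
Local Notation idx := ('I_m * 'I_n * mono)%type.
Local Notation nle := (nle abs cf).

Definition mxcf (u : idx) (X : V) : K := cf u.2 (X u.1.1 u.1.2).
Definition mxnle (X : V) r := forall i j, nle (X i j) r.
(** Position over term: the matrix entry is compared first, then the exponents. Multiplication by a
    monomial changes no position, so it respects this order. *)
Definition idx_coords : seq (idx -> nat) :=
  (fun u : idx => u.1.1 : nat) :: (fun u : idx => u.1.2 : nat) ::
  [seq (fun u : idx => u.2 i) | i <- enum I].
Definition idx_lt := lexlt idx_coords.
Definition idx_div (u v : idx) := (u.1 == v.1) && mnle u.2 v.2.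

Lemma idx_lt_total u v : ~~ idx_lt u v -> ~~ idx_lt v u -> u = v.
Proof.
move=> uv vu; have := lexlt_total uv vu; rewrite /= all_map => /and3P[/eqP H1 /eqP H2 /allP H3].
case: u v H1 H2 H3 {uv vu} => [[i j] a] [[i' j'] b] /= /val_inj -> /val_inj -> H3.
by congr (_, _); apply/ffunP => k; apply/eqP; apply: H3; rewrite mem_enum.
Qed.

Lemma idx_lt_mono (b : mono) u v :
  idx_lt u v -> idx_lt (u.1, mnadd u.2 b) (v.1, mnadd v.2 b).
Proof.
pose g (u : idx) : idx := (u.1, mnadd u.2 b).
apply: (@lexlt_mono _ _ g) => c x y /=.
  by move=> [<-|[<-|/List.in_map_iff[i [<- _]]]] //=; rewrite !ffunE ltn_add2r.
by move=> [<-|[<-|/List.in_map_iff[i [<- _]]]] //=; rewrite !ffunE => ->.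
Qed.

Lemma idx_dickson (P : idx -> Prop) : exists L : seq idx,
  (forall u, u \in L -> P u) /\ forall v, P v -> exists2 u, u \in L & idx_div u v.
Proof.
(* The complementary coordinates [m - i] and [n - j] make componentwise comparison force equal
   positions, as divisibility requires. *)
have [L [LP PL]] := finite_coord_basis
  ((fun u : idx => m - u.1.1)%N :: (fun u : idx => n - u.1.2)%N :: idx_coords) P.
exists L; split=> [u /In_mem /LP //|v /PL[u /In_mem uL le_uv]]; exists u => //.
have c1 := le_uv _ (or_introl erefl).
have c2 := le_uv _ (or_intror (or_introl erefl)).
have c3 := le_uv _ (or_intror (or_intror (or_introl erefl))).
have c4 := le_uv _ (or_intror (or_intror (or_intror (or_introl erefl)))).
apply/andP; split.
  case: u v c1 c2 c3 c4 {uL le_uv} => [[i j] a] [[i' j'] b] /= c1 c2 c3 c4.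
  have := ltn_ord i; have := ltn_ord j; have := ltn_ord i'; have := ltn_ord j' => *.
  by rewrite xpair_eqE -!val_eqE /=; apply/andP; split; lia.
apply/forallP => i; apply: (le_uv (fun u : idx => u.2 i)); do 4!right.
by apply: List.in_map; apply/In_mem; rewrite mem_enum.
Qed.

Lemma mxcfD u X Y : mxcf u (X + Y) = mxcf u X + mxcf u Y.
Proof. by rewrite /mxcf mxE (tl_add HA). Qed.
Lemma mxcfB u X Y : mxcf u (X - Y) = mxcf u X - mxcf u Y.
Proof. by rewrite /mxcf !mxE (cfB HA). Qed.
Lemma mxcf_inj X : (forall u, mxcf u X = 0) -> X = 0.
Proof.
by move=> H; apply/matrixP => i j; rewrite mxE; apply: (tl_inj HA) => al; apply: (H (i, j, al)).
Qed.
Lemma mxcf_term a b u X :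
  mxcf u (term a b *: X) = if mnle b u.2 then a * mxcf (u.1, mnsub u.2 b) X else 0.
Proof. by rewrite /mxcf mxE (tl_term HA). Qed.
Lemma mxnleP X r : mxnle X r <-> forall u, abs (mxcf u X) <= r.
Proof. by split=> [H u|H i j al]; [apply: H|apply: (H (i, j, al))]. Qed.
Lemma mxnleD X Y r : mxnle X r -> mxnle Y r -> mxnle (X + Y) r.
Proof. by move=> H1 H2 i j; rewrite mxE; apply: (nleD Habs HA). Qed.
Lemma mxnleB X Y r : mxnle X r -> mxnle Y r -> mxnle (X - Y) r.
Proof. by move=> H1 H2 i j; rewrite !mxE; apply: (nleB Habs HA). Qed.
Lemma mxnle_sum (J : Type) (s : seq J) F r :
  0 <= r -> (forall i, mxnle (F i) r) -> mxnle (\sum_(i <- s) F i) r.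
Proof.
by move=> r0 H i j; rewrite summxE; apply: (nle_sum Habs HA) => // k _; apply: H.
Qed.
Lemma mxnleZ a X r s : nle a r -> mxnle X s -> mxnle (a *: X) (r * s).
Proof. by move=> H1 H2 i j; rewrite mxE; apply: (nleM HA). Qed.
Lemma mxnle_small_eq0 X : (forall e, 0 < e -> mxnle X e) -> X = 0.
Proof.
move=> H; apply/matrixP => i j; rewrite mxE; apply: (nle_small_eq0 Habs HA) => e e0; exact: H.
Qed.

Lemma mxcf_finite X e : 0 < e -> exists L : seq idx, forall u, e < abs (mxcf u X) -> u \in L.
Proof.
move=> e0.
have /choice[N HN] (ij : 'I_m * 'I_n) := tl_null HA (X ij.1 ij.2) e0.
have [L HL] := finite_degree_lt I (\max_ij N ij).
exists (allpairs pair (enum {: 'I_m * 'I_n}) L) => [[ij al]] lt_e.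
apply/allpairsP; exists (ij, al); rewrite mem_enum; split=> //=.
apply: HL; rewrite ltnNge; apply/negP => le_al; move: lt_e; rewrite ltNge => /negP; apply.
by apply: HN; apply: leq_trans le_al; apply: leq_bigmax.
Qed.

(** Size comes first: the monomial order only breaks ties among coefficients of maximal absolute
    value. *)
Definition leading (X : V) (u : idx) := [/\ mxcf u X <> 0, forall v, abs (mxcf v X) <= abs (mxcf u X)
  & forall v, idx_lt u v -> abs (mxcf v X) < abs (mxcf u X)].

Lemma exists_leading X : X <> 0 -> exists u, leading X u.
Proof.
move=> X0; have [u0 nz] : exists u, mxcf u X <> 0.
  by apply: contrapT => /forallNP H; apply: X0; apply: mxcf_inj => u; apply: contrapT; apply: H.
have a0 : 0 < abs (mxcf u0 X) by apply: (abs_gt0 Habs); apply/eqP.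
have [L HL] := mxcf_finite X (divr_gt0 a0 (ltr0n _ 2)).
pose lt u v := abs (mxcf u X) < abs (mxcf v X) \/ abs (mxcf u X) = abs (mxcf v X) /\ idx_lt u v.
have [||||u [Pu uM]] := @maximal_in_seq _ (fun u => abs (mxcf u0 X) / 2 < abs (mxcf u X)) lt L.
- by move=> u [|[_]]; rewrite ?ltxx // /idx_lt lexlt_irr.
- move=> u v w [uv|[E uv]] [vw|[F vw]].
  + by left; apply: lt_trans uv vw.
  + by left; rewrite -F.
  + by left; rewrite E.
  + by right; rewrite E; split=> //; apply: lexlt_trans uv vw.
- by move=> u /HL/In_mem.
- by exists u0; lra.
have le v : abs (mxcf v X) <= abs (mxcf u X).
  rewrite leNgt; apply/negP => uv; apply: (uM v); last by left.
  exact: lt_trans Pu uv.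
exists u; split=> // [E|v uv]; first by move: Pu; rewrite E (abs0 Habs); lra.
have := le v; rewrite le_eqVlt => /orP[/eqP E|//].
by case: (uM v) => [|]; [rewrite E|right].
Qed.

Section Reduction.
Variables (k : nat) (g : 'I_k -> V) (mu : 'I_k -> idx) (q : R).
Hypotheses (g_lead : forall j, mxcf (mu j) (g j) = 1) (g_le1 : forall j, mxnle (g j) 1).
Hypothesis g_tail : forall j v, idx_lt (mu j) v -> abs (mxcf v (g j)) <= q.
Hypothesis q01 : 0 < q < 1.

Definition reducible v := exists j, idx_div (mu j) v.

(* Only finitely many monomials of [X] have size above [r * q]; cancelling the
   largest of them creates such terms at smaller monomials only. *)
Lemma reduction_step r X : 0 < r -> mxnle X r ->
  exists (h : 'I_k -> A) (Y X' : V), [/\ forall j, nle (h j) r, mxnle Y r,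
    forall v, reducible v -> mxcf v Y = 0, mxnle X' (r * q) &
    X = \sum_j h j *: g j + Y + X'].
Proof.
move=> r0; have /andP[q0 q1] := q01.
have rq0 : 0 < r * q by exact: mulr_gt0.
have base X0 : (forall v, abs (mxcf v X0) <= r * q) -> exists (h : 'I_k -> A) (Y X' : V),
    [/\ forall j, nle (h j) r, mxnle Y r, forall v, reducible v -> mxcf v Y = 0,
        mxnle X' (r * q) & X0 = \sum_j h j *: g j + Y + X'].
  move=> H; exists (fun _ => 0), 0, X0; split.
  - by move=> j; apply: (nle0 Habs HA); apply: ltW.
  - by move=> i j; rewrite mxE; apply: (nle0 Habs HA); apply: ltW.
  - by move=> v _; rewrite /mxcf mxE (cf0 HA).
  - exact/mxnleP.
  - by rewrite big1 ?addr0 ?add0r // => j _; rewrite scale0r.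
suff main u : forall X, mxnle X r -> (forall v, idx_lt u v -> abs (mxcf v X) <= r * q) ->
    exists (h : 'I_k -> A) (Y X' : V),
    [/\ forall j, nle (h j) r, mxnle Y r, forall v, reducible v -> mxcf v Y = 0,
        mxnle X' (r * q) & X = \sum_j h j *: g j + Y + X'].
  move=> Xr; have [[u0 Hu0]|none] := EM (exists u, r * q < abs (mxcf u X)); last first.
    by apply: base => v; rewrite leNgt; apply/negP => H; apply: none; exists v.
  have [L HL] := mxcf_finite X rq0.
  have [||||u [Pu uM]] := @maximal_in_seq _ (fun u => r * q < abs (mxcf u X)) (fun a b => idx_lt a b) L.
  - by move=> a; rewrite /idx_lt lexlt_irr.
  - by move=> a b c; apply: lexlt_trans.
  - by move=> v /HL/In_mem.
  - by exists u0.
  apply: (main u) => // v uv; rewrite leNgt; apply/negP => /uM; exact.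
elim/(well_founded_ind (lexlt_wf idx_coords)): u => u IH {}X Xr Xu.
(* One cancellation at [u] is enough. By the tail bound [q] it changes larger indices by at most
   [r * q], so afterwards only indices below [u] can exceed [r * q], and the induction hypothesis
   applies to the largest of them. *)
suff [h [Y [X' [H1 H2 H3 H4 H5]]]] : exists (h : 'I_k -> A) (Y X' : V),
    [/\ forall j, nle (h j) r, mxnle Y r, forall v, reducible v -> mxcf v Y = 0,
        mxnle X' r /\ (forall v, ~~ idx_lt v u -> abs (mxcf v X') <= r * q) &
        X = \sum_j h j *: g j + Y + X'].
  case: H4 => X'r X'u.
  have [[u0 Hu0]|none] := EM (exists u, r * q < abs (mxcf u X')); last first.
    exists h, Y, X'; split=> //.
    by apply/mxnleP => v; rewrite leNgt; apply/negP => H; apply: none; exists v.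
  have [L HL] := mxcf_finite X' rq0.
  have [||||u' [Pu uM]] := @maximal_in_seq _ (fun u => r * q < abs (mxcf u X')) (fun a b => idx_lt a b) L.
  - by move=> a; rewrite /idx_lt lexlt_irr.
  - by move=> a b c; apply: lexlt_trans.
  - by move=> v /HL/In_mem.
  - by exists u0.
  have lt_u' : idx_lt u' u by apply: contraT => /X'u; rewrite leNgt Pu.
  have [|h' [Y' [X'' [G1 G2 G3 G4 G5]]]] := IH u' lt_u' X' X'r.
    by move=> v uv; rewrite leNgt; apply/negP => /uM; exact.
  exists (fun j => h j + h' j), (Y + Y'), X''; split=> //.
  - by move=> j; apply: (nleD Habs HA).
  - exact: mxnleD.
  - by move=> v rv; rewrite mxcfD H3 // G3 // addr0.
  - have -> : \sum_j (h j + h' j) *: g j = \sum_j h j *: g j + \sum_j h' j *: g j.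
      by rewrite -big_split; apply: eq_bigr => j _; rewrite scalerDl.
    rewrite [LHS]H5 G5 !addrA; congr (_ + _ + _); exact: addrAC.
have cu : abs (mxcf u X) <= r by apply: (mxnleP X r).1.
have upto v : ~~ idx_lt v u -> v <> u -> idx_lt u v.
  by move=> nvu ne; apply: contraT => nuv; case: ne; apply: idx_lt_total.
have [[j /andP[/eqP E1 le_ju]]|irr] := EM (reducible u).
  pose b := mnsub u.2 (mu j).2; pose hj := fun i : 'I_k => if i == j then term (mxcf u X) b else 0.
  have sumh : \sum_i hj i *: g i = term (mxcf u X) b *: g j.
    rewrite (bigD1 j) //= /hj eqxx big1 ?addr0 // => i /negPf ->; by rewrite scale0r.
  have ucancel : u = (((mu j).1), mnadd (mu j).2 b).
    rewrite [LHS]surjective_pairing -E1; congr (_, _).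
    by apply/ffunP => i; rewrite !ffunE subnKC //; apply: (forallP le_ju).
  have cX' v : mxcf v (term (mxcf u X) b *: g j) =
      if mnle b v.2 then mxcf u X * mxcf (v.1, mnsub v.2 b) (g j) else 0 by exact: mxcf_term.
  have tr : mxnle (term (mxcf u X) b *: g j) r.
    apply/mxnleP => v; rewrite cX'; case: ifP => _; last by rewrite (abs0 Habs) ltW.
    rewrite (absM Habs) -[r]mulr1; apply: ler_pM => //; try exact: (abs_ge0 Habs).
    exact: (mxnleP _ _).1 (g_le1 j) _.
  have shift (v : idx) : mnle b v.2 -> v = ((v.1), mnadd (mnsub v.2 b) b).
    case: v => [a al] /= /forallP le_bv; congr pair.
    by apply/ffunP => i; move: (le_bv i); rewrite !ffunE => /subnK ->.
  have termle al : abs (cf al (term (mxcf u X) b)) <= r.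
    rewrite -[term _ _]mulr1 (tl_term HA); case: ifP => _; last by rewrite (abs0 Habs) ltW.
    rewrite (absM Habs) -[r]mulr1; apply: ler_pM => //; try exact: (abs_ge0 Habs).
    exact: (tl_one HA (mnsub al b)).
  exists hj, 0, (X - \sum_i hj i *: g i); split.
  - move=> i; rewrite /hj; case: eqP => _ ; first exact: termle.
    by apply: (nle0 Habs HA); exact: ltW.
  - by move=> i i'; rewrite mxE; apply: (nle0 Habs HA); apply: ltW.
  - by move=> v _; rewrite /mxcf mxE (cf0 HA).
  - rewrite sumh; split=> [|v nvu]; first exact: mxnleB.
    rewrite mxcfB; have [vu|vu] := eqVneq v u.
      have le_bu : mnle b u.2 by rewrite ucancel; apply/forallP => i; rewrite !ffunE leq_addl.
      have E : (u.1, mnsub u.2 b) = mu j.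
        rewrite [RHS]surjective_pairing {1}ucancel; congr pair.
        by rewrite [u in u.2]ucancel; apply/ffunP => i; rewrite !ffunE addnK.
      rewrite vu cX' le_bu E.
      by rewrite g_lead mulr1 subrr (abs0 Habs) ltW.
    have lt_uv := upto v nvu (elimN eqP vu).
    apply: (abs_leB Habs); first exact: Xu.
    rewrite cX'; case: ifP => [le_bv|_]; last by rewrite (abs0 Habs) ltW.
    rewrite (absM Habs); apply: ler_pM => //; try exact: (abs_ge0 Habs).
    apply: g_tail; apply: contraT => nlt.
    have [E|ne] := eqVneq (mu j) (v.1, mnsub v.2 b).
      by case/eqP: vu; rewrite ucancel (shift v le_bv) E.
    have := idx_lt_total nlt; have [lt _|_ /(_ isT) E] := boolP (idx_lt _ (mu j)); last first.
      by rewrite E eqxx in ne.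
    have := idx_lt_mono b lt; rewrite /= -shift // -ucancel => lt_vu.
    by rewrite lt_vu in nvu.
  - by rewrite addr0 addrC subrK.
(* No [mu j] divides [u]: the term at [u] itself is moved to the remainder [Y]. *)
have [y Hy] : exists y : A, forall al, cf al y = (al == u.2)%:R * mxcf u X.
  apply: (tl_surj HA) => e e0; exists (\sum_i u.2 i).+1 => al lt_al.
  have [E|_] := eqVneq al u.2; first by move: lt_al; rewrite E ltnn.
  by rewrite mul0r (abs0 Habs) ltW.
pose Y : V := y *: delta_mx u.1.1 u.1.2.
have cY v : mxcf v Y = (v == u)%:R * mxcf u X.
  have -> : (v == u) = (v.1.1 == u.1.1) && (v.1.2 == u.1.2) && (v.2 == u.2).
    by rewrite -pair_eqE /pair_eq -pair_eqE.
  rewrite /mxcf !mxE; case: andP => _ /=; first by rewrite mulr1 Hy.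
  by rewrite mulr0 (cf0 HA) mul0r.
exists (fun=> 0), Y, (X - Y); split.
- by move=> j; apply: (nle0 Habs HA); apply: ltW.
- apply/mxnleP => v; rewrite cY; case: eqP => _; rewrite ?mul1r // mul0r (abs0 Habs); exact: ltW.
- move=> v rv; rewrite cY; case: eqP => [E|]; rewrite ?mul0r //.
  by case: irr; rewrite -E.
- split=> [|v nvu]; first apply: mxnleB => //.
    apply/mxnleP => v; rewrite cY; case: eqP => _; rewrite ?mul1r // mul0r (abs0 Habs); exact: ltW.
  rewrite mxcfB cY; case: eqP => [->|ne]; first by rewrite mul1r subrr (abs0 Habs) ltW.
  by rewrite mul0r subr0; apply: Xu; apply: upto.
- rewrite big1 ?add0r => [|j _]; last by rewrite scale0r.
  by rewrite addrC subrK.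
Qed.

(** Iterating [reduction_step] on leftovers of norm at most [r * q ^+ i] turns quotients and
    remainder into convergent series. Coefficients at reducible indices vanish in each partial
    remainder, hence in the limit. *)
Lemma reduction r X : 0 < r -> mxnle X r ->
  exists (h : 'I_k -> A) (Y : V), [/\ forall j, nle (h j) r,
    forall v, reducible v -> mxcf v Y = 0 & X = \sum_j h j *: g j + Y].
Proof.
move=> r0 Xr; have /andP[q0 q1] := q01.
have /choice[F HF] (a : V * R) : exists b : ('I_k -> A) * V * V,
    0 < a.2 -> mxnle a.1 a.2 -> [/\ forall j, nle (b.1.1 j) a.2, mxnle b.1.2 a.2,
      forall v, reducible v -> mxcf v b.1.2 = 0, mxnle b.2 (a.2 * q) &
      a.1 = \sum_j b.1.1 j *: g j + b.1.2 + b.2].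
  case: a => [X0 r1]; have [r10|] := EM (0 < r1); last by exists ((fun=> 0), 0, 0).
  have [X0r|] := EM (mxnle X0 r1); last by exists ((fun=> 0), 0, 0).
  by have [h [Y [X' H]]] := reduction_step r10 X0r; exists (h, Y, X').
pose xs := fix xs i : V := if i is i'.+1 then (F (xs i', r * q ^+ i')).2 else X.
pose b i := F (xs i, r * q ^+ i).
have rq0 i : 0 < r * q ^+ i by rewrite mulr_gt0 ?exprn_gt0.
have xsr i : mxnle (xs i) (r * q ^+ i).
  elim: i => [|i IH]; first by rewrite expr0 mulr1.
  by rewrite exprSr mulrA; have [] := HF (xs i, r * q ^+ i) (rq0 i) IH.
have Hb i := HF (xs i, r * q ^+ i) (rq0 i) (xsr i).
have small e : 0 < e -> exists N, r * q ^+ N <= e.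
  move=> e0; have [|N HN] := @geometric_small _ q r e _ e0; first by rewrite ltW.
  by exists N; apply: HN.
have rqM N i : (N <= i)%N -> r * q ^+ i <= r * q ^+ N.
  move=> le_Ni; apply: ler_wpM2l; first exact: ltW.
  by apply: ler_wiXn2l => //; apply: ltW.
have sumA (s : nat -> A) : (forall i, nle (s i) (r * q ^+ i)) ->
    exists l, forall N, nle (l - \sum_(i < N) s i) (r * q ^+ N).
  move=> Hs; have [|l Hl] := tl_sum Habs HA (s := s).
    move=> e /small[N HN]; exists N => i /rqM le_i.
    by apply: nle_trans (Hs i); apply: le_trans le_i HN.
  by exists l => N; apply: Hl => i /rqM le_i; apply: nle_trans le_i (Hs i).
have /choice[h Hh] j := sumA (fun i => (b i).1.1 j) (fun i => let: And5 H _ _ _ _ := Hb i in H j).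
have /choice[y Hy] (ij : 'I_m * 'I_n) := sumA (fun i => (b i).1.2 ij.1 ij.2)
  (fun i => let: And5 _ H _ _ _ := Hb i in H ij.1 ij.2).
exists h, (\matrix_(i, j) y (i, j)).
have eq0 : X - (\sum_j h j *: g j + \matrix_(i, j) y (i, j)) = 0.
  apply: mxnle_small_eq0 => e /small[N HN].
  have XE : X = \sum_j (\sum_(i < N) (b i).1.1 j) *: g j + \sum_(i < N) (b i).1.2 + xs N.
    elim: N {HN} => [|N ->].
      by rewrite big_ord0 big1 ?add0r // => j _; rewrite big_ord0 scale0r.
    have [_ _ _ _ /= {1}->] := Hb N; rewrite -/(b N) big_ord_recr /=.
    under [in RHS]eq_bigr do rewrite big_ord_recr /= scalerDl.
    by rewrite big_split /= !addrA; congr (_ + _ + _); rewrite addrAC.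
  rewrite {1}XE (_ : _ - _ = xs N - (\sum_j (h j - \sum_(i < N) (b i).1.1 j) *: g j
     + (\matrix_(i, j) y (i, j) - \sum_(i < N) (b i).1.2))); last first.
    have -> : \sum_j (h j - \sum_(i < N) (b i).1.1 j) *: g j =
        \sum_j h j *: g j - \sum_j (\sum_(i < N) (b i).1.1 j) *: g j.
      by rewrite -sumrB; apply: eq_bigr => j _; rewrite scalerBl.
    by rewrite [in RHS]addrACA -[in RHS]opprD opprB [in RHS]addrA [xs N + _]addrC.
  have le1 Z : mxnle Z (r * q ^+ N) -> mxnle Z e.
    by move=> H i j; apply: nle_trans (H i j).
  apply: mxnleB; first exact/le1.
  apply: mxnleD; apply: le1.
    apply: mxnle_sum => [|j]; first exact: ltW.
    by rewrite -[r * _]mulr1; apply: mxnleZ.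
  by move=> i j; rewrite !mxE summxE; apply: Hy.
split=> [j|v rv|]; last by apply/eqP; rewrite -subr_eq0 eq0.
- by have := Hh j 0%N; rewrite big_ord0 subr0 expr0 mulr1.
- rewrite /mxcf mxE; apply: (abs_small_eq0 Habs) => e /small[N HN].
  apply: le_trans HN; have := Hy (v.1.1, v.1.2) N v.2; rewrite (cfB HA) (cf_sum HA) big1 ?subr0 //.
  by move=> i _; have [_ _ /(_ v rv)] := Hb i.
Qed.

End Reduction.

Lemma common_bound_lt1 k (d : 'I_k -> R) : (forall j, d j < 1) ->
  exists2 q, 0 < q < 1 & forall j, d j <= q.
Proof.
move=> d1; have h0 : (0 : R) < 1 / 2 by rewrite divr_gt0.
have h1 : 1 / 2 < 1 :> R by lra.
exists (\big[Num.max/1 / 2]_j d j) => [|j]; last exact: le_bigmax.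
by rewrite (lt_le_trans h0 (bigmax_ge_id _ _ _ _)) bigmax_lt.
Qed.

(** Dickson's lemma selects finitely many leading indices, one of which divides any other. The
    remainder of an element of [U] is again in [U]; if nonzero, it would have a reducible leading
    index, where its coefficient is 0. *)
Lemma bounded_division (U : V -> Prop) : submodule U ->
  exists (k : nat) (g : 'I_k -> V), (forall j, U (g j)) /\
    forall X r, 0 < r -> U X -> mxnle X r ->
      exists h : 'I_k -> A, (forall j, nle (h j) r) /\ X = \sum_j h j *: g j.
Proof.
move=> HU; have [U0 UD UZ] := HU.
have [L [LP PL]] := idx_dickson (fun u => exists2 X, U X & leading X u).
pose mu j := tnth (in_tuple L) j.
have /choice[g Hg] j : exists X, [/\ U X, mxcf (mu j) X = 1, mxnle X 1 &
    exists2 q, q < 1 & forall v, idx_lt (mu j) v -> abs (mxcf v X) <= q].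
  have [X UX [nz le_lead lt_lead]] := LP (mu j) (mem_tnth _ _).
  set c := mxcf (mu j) X in nz le_lead lt_lead.
  have c0 : c != 0 by apply/eqP.
  pose X1 : V := term c^-1 [ffun=> 0%N] *: X.
  have cX1 v : mxcf v X1 = c^-1 * mxcf v X.
    rewrite mxcf_term (_ : mnle _ _) => [|]; last by apply/forallP => i; rewrite ffunE.
    congr (_ * mxcf _ X); rewrite [RHS]surjective_pairing; congr pair.
    by apply/ffunP => i; rewrite !ffunE subn0.
  have ac0 : 0 < abs c by exact: (abs_gt0 Habs).
  exists X1; split; first exact: UZ.
  - by rewrite cX1 mulVf.
  - apply/mxnleP => v; rewrite cX1 (absM Habs) (absV Habs) mulrC ler_pdivrMr // mul1r; exact: le_lead.
  - have lt1 v : idx_lt (mu j) v -> abs (mxcf v X1) < 1.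
      by rewrite cX1 (absM Habs) (absV Habs) mulrC ltr_pdivrMr // mul1r; exact: lt_lead.
    have h0 : (0 : R) < 1 / 2 by rewrite divr_gt0.
    have [L' HL'] := mxcf_finite X1 h0.
    (* A uniform bound below 1 is extracted from infinitely many strict ones: only finitely many
       coefficients exceed 1/2, and their maximum is attained. *)
    have [ex|none] := EM (exists v, idx_lt (mu j) v /\ 1 / 2 < abs (mxcf v X1)); last first.
      exists (1 / 2); first by lra.
      by move=> v lt_v; rewrite leNgt; apply/negP => H; apply: none; exists v.
    have [||||w [[lt_w hw] wM]] := @maximal_in_seq _
      (fun v => idx_lt (mu j) v /\ 1 / 2 < abs (mxcf v X1))
      (fun u v => abs (mxcf u X1) < abs (mxcf v X1)) L'.
    + by move=> v; rewrite ltxx.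
    + by move=> u v w; apply: lt_trans.
    + by move=> v [_ /HL'/In_mem].
    + exact: ex.
    exists (abs (mxcf w X1)); first exact: lt1.
    move=> v lt_v; rewrite leNgt; apply/negP => H; apply: (wM v) => //; split=> //.
    exact: lt_trans hw H.
have /choice[d Hd] j : exists q, q < 1 /\ forall v, idx_lt (mu j) v -> abs (mxcf v (g j)) <= q.
  by have [_ _ _ [q]] := Hg j; exists q.
have [q q01 dq] := common_bound_lt1 (fun j => (Hd j).1).
exists _, g; split=> [j|X r r0 UX Xr]; first by case: (Hg j).
have gl j : mxcf (mu j) (g j) = 1 by case: (Hg j).
have g1 j : mxnle (g j) 1 by case: (Hg j).
have gt j v : idx_lt (mu j) v -> abs (mxcf v (g j)) <= q.
  by move=> lt_v; apply: le_trans (dq j); apply: (Hd j).2.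
have [h [Y [hr Y0 XE]]] := reduction gl g1 gt q01 r0 Xr.
have UY : U Y.
  have -> : Y = X - \sum_j h j *: g j by rewrite XE addrC addKr.
  apply: submodB => //; apply: submod_sum => // j _; apply: UZ; by case: (Hg j).
exists h; split=> //; rewrite {1}XE; suff -> : Y = 0 by rewrite addr0.
apply: contrapT => /exists_leading[u uY]; have [nz _ _] := uY; apply: nz; apply: Y0.
have [|w wL wu] := PL u; first by exists Y.
have /tnthP[j jw] : w \in in_tuple L by [].
by exists j; rewrite /mu -jw.
Qed.

End BoundedDivision.

(** * Units of the Tate algebra *)

Section TateAlgebra.
Variables (R : realType) (K : fieldType) (abs : K -> R).
Hypothesis Habs : nonarch_complete_abs abs.
Variables (d : nat) (S : comAlgType K) (x : 'I_d -> S) (coef : mon d -> S -> K).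
Hypothesis HT : is_Tate_algebra abs x coef.
Local Notation nle := (nle abs coef).

Lemma tcoefD al f g : coef al (f + g) = coef al f + coef al g.
Proof. by have [H _] := HT; rewrite -[f]scale1r H mul1r scale1r. Qed.

Lemma tcoef0 al : coef al 0 = 0.
Proof. by apply: (addrI (coef al 0)); rewrite -tcoefD !addr0. Qed.

Lemma tcoefZ al a f : coef al (a *: f) = a * coef al f.
Proof. by have [H _] := HT; rewrite -[a *: f]addr0 H tcoef0 addr0. Qed.

Lemma tcoefM al f g : coef al (f * g) = conv al (coef^~ f) (coef^~ g).
Proof. by have [_ [_ [_ [_ [H _]]]]] := HT. Qed.

Lemma tcoef1 al : coef al 1 = (al == mon0 d)%:R.
Proof. by have [_ [_ [_ [_ [_ [H _]]]]]] := HT. Qed.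

Lemma coef_surj (a : mon d -> K) : null_family abs a -> exists f : S, forall al, coef al f = a al.
Proof. by have [_ [_ [_ [H _]]]] := HT; apply: H. Qed.

Lemma leq_mdeg (b : mon d) i : (b i <= mdeg b)%N.
Proof. by rewrite /mdeg (bigD1 i) //= leq_addr. Qed.

Lemma mon_of_bij (b g : mon d) : mnle b g -> exists a : {ffun 'I_d -> 'I_(mdeg g).+1},
  mon_of a = b /\ forall a', mon_of a' = b -> a' = a.
Proof.
move=> /forallP bg; exists [ffun i => inord (b i)]; split=> [|a' E].
  apply/ffunP => i; rewrite !ffunE inordK // ltnS; exact: leq_trans (bg i) (leq_mdeg g i).
by apply/ffunP => i; rewrite -E !ffunE inord_val.
Qed.

Lemma coef_single b a : exists f, forall al, coef al f = (al == b)%:R * a.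
Proof.
apply: coef_surj => e e0; exists (mdeg b).+1 => al lt_al.
have [E|_] := eqVneq al b; first by move: lt_al; rewrite E ltnn.
by rewrite mul0r (abs0 Habs).
Qed.

Lemma coef_single_mul X a b : (forall al, coef al X = (al == b)%:R * a) ->
  forall f g, coef g (X * f) = if mnle b g then a * coef (mnsub g b) f else 0.
Proof.
move=> HX f g; rewrite tcoefM /conv; case: ifP => [bg|nbg].
  have [a0 [E U]] := mon_of_bij bg; rewrite (bigD1 a0) /=; last first.
    by apply/forallP => i; move: (forallP bg i); rewrite -E !ffunE.
  rewrite E HX eqxx mul1r big1 ?addr0 // => a' /andP[_ ne].
  rewrite HX; case: eqP => [/U E'|]; last by rewrite !mul0r.
  by rewrite E' eqxx in ne.
rewrite big1 // => a' le_a'; rewrite HX; case: eqP => [E|]; last by rewrite !mul0r.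
by rewrite -E in nbg; case/negP: nbg; apply/forallP => i; rewrite ffunE; exact: (forallP le_a').
Qed.

Lemma Tate_tatelike : exists term, tatelike abs coef term.
Proof.
have /choice[t Ht] (ab : K * mon d) := coef_single ab.2 ab.1.
exists (fun a b => t (a, b)); split.
- exact: tcoefD.
- by have [_ [H _]] := HT.
- have [_ [_ [H _]]] := HT; move=> f e /(H f)[N HN]; exists N => al /HN; exact: ltW.
- move=> a Ha; apply: coef_surj => e e0; have [|N HN] := Ha (e / 2); first exact: divr_gt0.
  by exists N => al /HN le; apply: le_lt_trans le _; lra.
- move=> f g r s fr gs al.
  have r0 : 0 <= r by apply: le_trans (abs_ge0 Habs _) (fr al).
  have s0 : 0 <= s by apply: le_trans (abs_ge0 Habs _) (gs al).
  rewrite tcoefM; apply: (abs_le_sum Habs) => [|a _]; first exact: mulr_ge0.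
  by rewrite (absM Habs); apply: ler_pM => //; apply: (abs_ge0 Habs).
- by move=> al; rewrite tcoef1; case: eqP; rewrite ?(abs1 Habs) ?(abs0 Habs).
- move=> a b f al; exact: (coef_single_mul (Ht (a, b))).
Qed.

Lemma nleZ a f r : nle f r -> nle (a *: f) (abs a * r).
Proof. by move=> fr al; rewrite tcoefZ (absM Habs); apply: ler_wpM2l => //; apply: (abs_ge0 Habs). Qed.

Lemma nle1 : nle 1 1.
Proof. by move=> al; rewrite tcoef1; case: eqP; rewrite ?(abs1 Habs) ?(abs0 Habs). Qed.

Local Notation lm f u := (leading abs coef (const_mx f : 'M_(1, 1)) u).

(* Leading monomials are multiplicative, so that of a unit is 1. *)
Lemma unit_const_dominant u v : u * v = 1 ->
  forall al, al <> mon0 d -> abs (coef al u) < abs (coef (mon0 d) u).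
Proof.
move=> uv1; have [term HS] := Tate_tatelike.
have ex f : f <> 0 -> exists w, lm f w.
  move=> f0; apply: (exists_leading Habs HS) => /matrixP/(_ ord0 ord0).
  by rewrite !mxE.
have u0 : u <> 0 by move=> E; move: uv1; rewrite E mul0r => /eqP; rewrite eq_sym oner_eq0.
have v0 : v <> 0 by move=> E; move: uv1; rewrite E mulr0 => /eqP; rewrite eq_sym oner_eq0.
have [[[i j] a] [nza lea lta]] := ex u u0; have [[[i' j'] b] [nzb leb ltb]] := ex v v0.
have [z _] : exists z : 'I_1 * 'I_1, true by exists (ord0, ord0).
have E1 (w w' : 'I_1 * 'I_1) : w = w' by rewrite [w]surjective_pairing [w']surjective_pairing !(ord1 w.1) !(ord1 w.2) !(ord1 w'.1) !(ord1 w'.2).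
rewrite (E1 (i, j) z) (E1 (i', j') z) {i j i' j'} in nza lea lta nzb leb ltb.
have cfE f w : mxcf coef w (const_mx f : 'M_(1, 1)) = coef w.2 f by rewrite /mxcf mxE.
have {}lea c : abs (coef c u) <= abs (coef a u) by have := lea (z, c); rewrite !cfE.
have {}leb c : abs (coef c v) <= abs (coef b v) by have := leb (z, c); rewrite !cfE.
have {}lta c : idx_lt (z, a) (z, c) -> abs (coef c u) < abs (coef a u) by move/lta; rewrite !cfE.
have {}ltb c : idx_lt (z, b) (z, c) -> abs (coef c v) < abs (coef b v) by move/ltb; rewrite !cfE.
rewrite !cfE /= in nza nzb.
have au : 0 < abs (coef a u) by apply: (abs_gt0 Habs); apply/eqP.
have bv : 0 < abs (coef b v) by apply: (abs_gt0 Habs); apply/eqP.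
pose g := mnadd a b; have le_ag : mnle a g by apply/forallP => i; rewrite !ffunE leq_addr.
have [a0 [Ea0 Ua0]] := mon_of_bij le_ag.
have gab : msub g a = b by apply/ffunP => i; rewrite !ffunE addKn.
have a0g : [forall i, (a0 i <= g i)%N].
  by apply/forallP => i; move: (forallP le_ag i); rewrite -Ea0 !ffunE.
(* In the convolution at [g] the product of the two leading coefficients strictly dominates every
   other term and cannot cancel; since [u * v = 1], this index is 0. *)
have g0 : g = mon0 d.
  apply: contrapT => ng0; have : coef g (u * v) = 0 by rewrite uv1 tcoef1; case: eqP.
  rewrite tcoefM /conv (bigD1 a0) //= Ea0 gab => /eqP; rewrite addr_eq0 => /eqP E.
  have := congr1 abs E; rewrite (absN Habs) (absM Habs) => EE.
  suff : abs (coef a u) * abs (coef b v) < abs (coef a u) * abs (coef b v) by rewrite ltxx.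
  rewrite {1}EE; apply: (abs_lt_sum Habs) => [|c /andP[/forallP cg nc]]; first exact: mulr_gt0.
  rewrite (absM Habs); set m := mon_of c; set m' := msub g m.
  have mm' : mnadd m m' = g by apply/ffunP => i; move: (cg i); rewrite !ffunE => /subnKC.
  have nma : m <> a by move=> /Ua0 E'; rewrite E' eqxx in nc.
  (* Either [m] is above [a], or [m] is below [a] and then [m'] is above [b]; each case gives a
     strict inequality. *)
  have [lt_am|nlt_am] := boolP (idx_lt (z, a) (z, m)).
    apply: le_lt_trans (_ : _ <= abs (coef m u) * abs (coef b v)) _.
      by apply: ler_wpM2l; rewrite ?(abs_ge0 Habs).
    by rewrite ltr_pM2r // lta.
  apply: le_lt_trans (_ : _ <= abs (coef a u) * abs (coef m' v)) _.
    by apply: ler_wpM2r; rewrite ?(abs_ge0 Habs).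
  rewrite ltr_pM2l // ltb //.
  have lt_ma : idx_lt (z, m) (z, a).
    by apply: contraT => nlt; case: nma; case: (idx_lt_total nlt_am nlt).
  have addC (e f : mon d) : mnadd e f = mnadd f e by apply/ffunP => i; rewrite !ffunE addnC.
  apply: contraT => nlt; have [lt_m'b|nlt'] := boolP (idx_lt (z, m') (z, b)).
    have := idx_lt_mono m' lt_ma; have := idx_lt_mono a lt_m'b; rewrite /= mm' (addC m' a) (addC b a).
    by move=> H1 H2; have := lexlt_trans H2 H1; rewrite lexlt_irr.
  case: nma; case: (idx_lt_total nlt nlt') => E'.
  by apply/ffunP => i; move/ffunP/(_ i): mm'; rewrite -E' !ffunE => /addIn.
have a00 : a = mon0 d.
  by apply/ffunP => i; move/ffunP/(_ i): g0; rewrite !ffunE => /eqP; rewrite addn_eq0 => /andP[/eqP].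
move=> al nal; rewrite -a00; apply: lta; apply: contraT => nlt.
have [lt|nlt'] := boolP (idx_lt (z, al) (z, a)); last first.
  by case: nal; rewrite -a00; case: (idx_lt_total nlt nlt').
move: lt; rewrite a00 /idx_lt => lt.
have : forall cs : seq ('I_1 * 'I_1 * mon d -> nat), List.Forall (fun c => c (z, mon0 d) <= c (z, al))%N cs ->
   ~~ lexlt cs (z, al) (z, mon0 d).
  elim=> //= c cs IH /List.Forall_cons_iff[Hc /IH nl]; rewrite negb_or -leqNgt Hc /=.
  by apply/nandP; right.
move=> /(_ (idx_coords 'I_d 1 1)); rewrite lt => H; suff: false by []; apply: H.
apply/List.Forall_forall => c /= [<- //|[<- //|/List.in_map_iff[i [<- _]]]].
by rewrite /= ffunE.
Qed.
End TateAlgebra.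

Section SmallPerturbation.
Variables (R : realType) (K : fieldType) (abs : K -> R).
Hypothesis Habs : nonarch_complete_abs abs.
Variables (I : finType) (A : comNzRingType) (cf : {ffun I -> nat} -> A -> K).
Variable (term : K -> {ffun I -> nat} -> A).
Hypothesis HA : tatelike abs cf term.
Local Notation nle := (nle abs cf).

Lemma nleX w r n : nle w r -> nle (w ^+ n) (r ^+ n).
Proof.
move=> wr; elim: n => [|n IH]; first by rewrite !expr0; exact: (tl_one HA).
by rewrite !exprS; apply: (nleM HA).
Qed.

Lemma one_sub_inv w q : nle w q -> q < 1 -> exists v, (1 - w) * v = 1.
Proof.
move=> wq q1; have q0 := nle_ge0 Habs wq; have q01 : 0 <= q < 1 by rewrite q0.
have [|v Hv] := tl_sum Habs HA (s := fun k => w ^+ k).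
  apply: (nle_geometric_null (r := 1) q01) => k; rewrite mul1r; exact: nleX.
exists v; apply/eqP; rewrite -subr_eq0; apply/eqP; apply: (nle_small_eq0 Habs HA) => e e0.
have [N HN] := geometric_small 1 q01 e0.
have le_e : q ^+ N <= e by rewrite -[q ^+ N]mul1r; apply: HN.
have E : (1 - w) * v - 1 = (1 - w) * (v - \sum_(k < N) w ^+ k) - w ^+ N.
  have P : (1 - w) * \sum_(k < N) w ^+ k = 1 - w ^+ N by rewrite -[1 - w]opprB mulNr -subrX1 opprB.
  by rewrite mulrBr P; ring.
rewrite E; apply: (nleB Habs HA); last exact: nle_trans le_e (nleX N wq).
rewrite -[e]mul1r; apply: (nleM HA).
  by apply: (nleB Habs HA); [exact: (tl_one HA)|apply: nle_trans wq; apply: ltW].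
apply: nle_trans le_e _; apply: Hv => k le_k; apply: nle_trans (nleX k wq).
by apply: ler_wiXn2l => //; apply: ltW.
Qed.
End SmallPerturbation.

(** * The ring S<z> *)

Section RestrictedSeries.
Variables (R : realType) (K : fieldType) (abs : K -> R).
Hypothesis Habs : nonarch_complete_abs abs.
Variables (d : nat) (S : comAlgType K) (x : 'I_d -> S) (coef : mon d -> S -> K).
Hypothesis HT : is_Tate_algebra abs x coef.
Local Notation nle := (nle abs coef).

Definition null_series (f : nat -> S) :=
  forall e, 0 < e -> exists N, forall k, (N <= k)%N -> nle (f k) e.
Definition cauchy_prod (f g : nat -> S) (k : nat) := \sum_(i < k.+1) f i * g (k - i)%N.

(* The hypotheses are parameters of the type, so that the ring structure, whose
   construction uses them, can be inferred from the type alone. *)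
Definition zseries (_ : nonarch_complete_abs abs) (_ : is_Tate_algebra abs x coef) : Type :=
  {f : nat -> S | null_series f}.
Local Notation A := (zseries Habs HT).

HB.instance Definition _ := gen_eqMixin A.
HB.instance Definition _ := gen_choiceMixin A.

Definition zcoef (f : A) : nat -> S := sval f.
Lemma zcoef_null f : null_series (zcoef f). Proof. exact: svalP f. Qed.
Definition mkz (f : nat -> S) (Hf : null_series f) : A := exist _ f Hf.
Lemma zext (f g : A) : zcoef f =1 zcoef g -> f = g.
Proof.
case: f g => [f Hf] [g Hg] /= /funext E; move: Hf Hg; rewrite /zcoef /= in E *; rewrite E.
by move=> Hf Hg; congr exist; apply: Prop_irrelevance.
Qed.

Let HS : exists term, tatelike abs coef term := Tate_tatelike Habs HT.

Lemma null_series0 : null_series (fun=> 0).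
Proof. by case: HS => t H e e0; exists 0%N => k _; apply: (nle0 Habs H); apply: ltW. Qed.
Lemma null_seriesN f : null_series f -> null_series (fun k => - f k).
Proof. by case: HS => t H Hf e /Hf[N HN]; exists N => k /HN; apply: (nleN Habs H). Qed.
Lemma null_seriesD f g : null_series f -> null_series g -> null_series (fun k => f k + g k).
Proof.
case: HS => t H Hf Hg e e0; have [N HN] := Hf e e0; have [M HM] := Hg e e0.
exists (maxn N M) => k; rewrite geq_max => /andP[/HN ? /HM ?]; exact: (nleD Habs H).
Qed.
Lemma null_series_bounded f : null_series f -> exists2 r, 0 < r & forall k, nle (f k) r.
Proof.
case: HS => t H Hf; have [N HN] := Hf 1 ltr01.
have /choice[b Hb] k : exists r, 0 < r /\ nle (f k) r.
  by have [r] := nle_bounded Habs H (f k); exists r.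
have b0 k : 0 <= b k by apply: ltW; have [] := Hb k.
exists (1 + \sum_(k < N) b k) => [|k].
  by apply: ltr_pwDl => //; apply: sumr_ge0.
have [/HN|lt_k] := leqP N k.
  by apply: nle_trans; rewrite lerDl; apply: sumr_ge0.
have [_] := Hb k; apply: nle_trans; rewrite (bigD1 (Ordinal lt_k)) //= addrCA lerDl.
by apply: addr_ge0 => //; apply: sumr_ge0.
Qed.
Lemma null_seriesM f g : null_series f -> null_series g -> null_series (cauchy_prod f g).
Proof.
case: HS => t H Hf Hg e e0.
have [a a0 fa] := null_series_bounded Hf; have [b b0 gb] := null_series_bounded Hg.
have [N HN] := Hf _ (divr_gt0 e0 b0); have [M HM] := Hg _ (divr_gt0 e0 a0).
exists (N + M)%N => k le_k; apply: (nle_sum Habs H) => [|i _]; first exact: ltW.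
have [le_i|lt_i] := leqP N i.
  by have -> : e = e / b * b; [rewrite divfK ?gt_eqF|apply: (nleM H) => //; apply: HN].
have -> : e = a * (e / a) by rewrite mulrC divfK ?gt_eqF.
by apply: (nleM H) => //; apply: HM; lia.
Qed.
Lemma null_seriesC (a : S) m : null_series (fun k => if k == m then a else 0).
Proof.
case: HS => t H e e0; exists m.+1 => k lt_k; case: eqP => [E|_]; first by lia.
by apply: (nle0 Habs H); apply: ltW.
Qed.

Definition z0 : A := mkz null_series0.
Definition zopp (f : A) : A := mkz (null_seriesN (zcoef_null f)).
Definition zadd (f g : A) : A := mkz (null_seriesD (zcoef_null f) (zcoef_null g)).
Definition zmul (f g : A) : A := mkz (null_seriesM (zcoef_null f) (zcoef_null g)).
Definition zone : A := mkz (null_seriesC 1 0).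

Fact zaddA : associative zadd. Proof. by move=> f g h; apply: zext => k; apply: addrA. Qed.
Fact zaddC : commutative zadd. Proof. by move=> f g; apply: zext => k; apply: addrC. Qed.
Fact zadd0 : left_id z0 zadd. Proof. by move=> f; apply: zext => k; apply: add0r. Qed.
Fact zaddN : left_inverse z0 zopp zadd. Proof. by move=> f; apply: zext => k; apply: addNr. Qed.
HB.instance Definition _ := GRing.isZmodule.Build A zaddA zaddC zadd0 zaddN.

Let trunc n (f : nat -> S) := \poly_(i < n) f i.
(** Coefficient [k] involves only the terms up to [k], so commutativity and associativity are
    borrowed from polynomials by truncation. *)
Lemma cauchy_prod_trunc f g n k : (k < n)%N -> cauchy_prod f g k = (trunc n f * trunc n g)`_k.
Proof.
move=> lt_kn; rewrite coefM; apply: eq_bigr => i _; rewrite !coef_poly.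
by have := ltn_ord i => *; rewrite !ifT //; lia.
Qed.
Fact zmulC : commutative zmul.
Proof. by move=> f g; apply: zext => k; rewrite /= !(cauchy_prod_trunc _ _ (ltnSn k)) mulrC. Qed.
Fact zmulA : associative zmul.
Proof.
have E f g h k : cauchy_prod (cauchy_prod f g) h k = (trunc k.+1 f * trunc k.+1 g * trunc k.+1 h)`_k.
  rewrite [RHS]coefM; apply: eq_bigr => i _.
  have := ltn_ord i => lt_i; rewrite (cauchy_prod_trunc _ _ lt_i) coef_poly ifT //; lia.
move=> f g h; apply: zext => k; rewrite -[zmul f (zmul g h)]zmulC /= !E.
by rewrite mulrC mulrA.
Qed.
Fact zmul1 : left_id zone zmul.
Proof.
move=> f; apply: zext => k; rewrite /= /cauchy_prod big_ord_recl /= mul1r subn0.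
by rewrite big1 ?addr0 // => i _; rewrite mul0r.
Qed.
Fact zmulDl : left_distributive zmul zadd.
Proof.
move=> f g h; apply: zext => k; rewrite /= /cauchy_prod -big_split; apply: eq_bigr => i _.
exact: mulrDl.
Qed.
Fact zone_neq0 : zone != 0.
Proof. by apply/eqP => /(congr1 (fun f => zcoef f 0%N))/eqP; rewrite /= oner_eq0. Qed.
HB.instance Definition _ := GRing.Zmodule_isComNzRing.Build A zmulA zmulC zmul1 zmulDl zone_neq0.

Lemma zcoefD f g k : zcoef (f + g) k = zcoef f k + zcoef g k. Proof. by []. Qed.
Lemma zcoefN f k : zcoef (- f) k = - zcoef f k. Proof. by []. Qed.
Lemma zcoef0 k : zcoef 0 k = 0. Proof. by []. Qed.
Lemma zcoef1 k : zcoef 1 k = (if k == 0%N then 1 else 0). Proof. by []. Qed.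
Lemma zcoefM f g k : zcoef (f * g) k = \sum_(i < k.+1) zcoef f i * zcoef g (k - i). Proof. by []. Qed.

Definition zmonom (a : S) m : A := mkz (null_seriesC a m).
Lemma zcoef_monomM a m f k :
  zcoef (zmonom a m * f) k = if (m <= k)%N then a * zcoef f (k - m) else 0.
Proof.
rewrite zcoefM; case: leqP => [le_mk|lt_km].
  rewrite (bigD1 (Ordinal (le_mk : (m < k.+1)%N))) //= eqxx big1 ?addr0 // => i.
  by rewrite -val_eqE /= => /negPf ->; rewrite mul0r.
by rewrite big1 // => i _ /=; have := ltn_ord i => lt_i; rewrite ifF ?mul0r //; lia.
Qed.

Definition zC (a : S) : A := zmonom a 0.
Definition zX : A := zmonom 1 1.
Lemma zcoefC a k : zcoef (zC a) k = if k == 0%N then a else 0. Proof. by []. Qed.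
Lemma zC_is_additive : zmod_morphism zC.
Proof. by move=> a b; apply: zext => k; rewrite zcoefD zcoefN !zcoefC; case: eqP; rewrite ?subr0. Qed.
Lemma zC_is_monoid : monoid_morphism zC.
Proof.
split=> // a b; apply: zext => k; rewrite zcoef_monomM leq0n subn0 !zcoefC; case: eqP => // _.
by rewrite mulr0.
Qed.
HB.instance Definition _ := GRing.isZmodMorphism.Build S A zC zC_is_additive.
HB.instance Definition _ := GRing.isMonoidMorphism.Build S A zC zC_is_monoid.

Lemma zcoefCM a f k : zcoef (zC a * f) k = a * zcoef f k.
Proof. by rewrite zcoef_monomM subn0. Qed.
Lemma zcoefXM f k : zcoef (zX * f) k = if k is k'.+1 then zcoef f k' else 0.
Proof. by rewrite zcoef_monomM; case: k => //= k; rewrite subn1 mul1r. Qed.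

Definition znle (f : A) r := forall k, nle (zcoef f k) r.
(** The exponent of z sits at [None]. *)
Definition zmcoef (al : {ffun option 'I_d -> nat}) (f : A) : K :=
  coef [ffun i => al (Some i)] (zcoef f (al None)).
Definition zmon (al : mon d) k : {ffun option 'I_d -> nat} := [ffun o => oapp al k o].
Lemma zmcoef_zmon al k f : zmcoef (zmon al k) f = coef al (zcoef f k).
Proof. by rewrite /zmcoef !ffunE; congr coef; apply/ffunP => i; rewrite !ffunE. Qed.
Lemma zmonK (al : {ffun option 'I_d -> nat}) : zmon [ffun i => al (Some i)] (al None) = al.
Proof. by apply/ffunP => -[i|]; rewrite !ffunE /= ?ffunE. Qed.
Lemma zmdeg (al : {ffun option 'I_d -> nat}) :
  (\sum_o al o = al None + mdeg [ffun i => al (Some i)])%N.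
Proof.
rewrite (bigD1 None) //=; congr (_ + _)%N; rewrite /mdeg.
rewrite (reindex_omap Some id) => [|[i|]] //=.
by apply: eq_big => i; rewrite ?ffunE // eqxx.
Qed.
Lemma znleP f r : znle f r <-> forall al, abs (zmcoef al f) <= r.
Proof.
split=> [H al|H k al]; first exact: H.
by rewrite -zmcoef_zmon.
Qed.

Lemma zseries_tatelike : exists term, tatelike abs zmcoef term.
Proof.
case: HS => t H.
exists (fun a b => zmonom (t a [ffun i => b (Some i)]) (b None)); split.
- by move=> al f g; rewrite /zmcoef zcoefD (tl_add H).
- by move=> f f0; apply: zext => k; apply: (tl_inj H) => al; rewrite -zmcoef_zmon.
- move=> f e e0; have [N HN] := zcoef_null f e0.
  have /choice[b Hb] k := tl_null H (zcoef f k) e0.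
  exists (N + \max_(k < N) b k)%N => al; rewrite zmdeg => le_al.
  have [/HN|lt_N] := leqP N (al None); first by apply.
  apply: Hb; apply: leq_trans (leq_bigmax (F := fun k : 'I_N => b k) (Ordinal lt_N)) _.
  rewrite -(leq_add2l N); apply: leq_trans le_al _.
  by rewrite leq_add2r; apply: ltnW.
- move=> a Ha.
  have sm k e : 0 < e -> exists N, forall al : mon d, (N <= \sum_i al i)%N -> abs (a (zmon al k)) <= e.
    move=> /Ha[N HN]; exists N => al le_al; apply: HN; rewrite zmdeg.
    apply: leq_trans le_al _; rewrite -[leqLHS]addn0 addnC leq_add //.
    by apply: leq_sum => i _; rewrite !ffunE.
  have /choice[f Hf] k := tl_surj H (sm k).
  have nf : null_series f.
    move=> e /Ha[N HN]; exists N => k le_k al; rewrite Hf; apply: HN; rewrite zmdeg ffunE /=.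
    exact: leq_trans le_k (leq_addr _ _).
  by exists (mkz nf) => al; rewrite /zmcoef /= Hf zmonK.
- move=> f g r s /znleP fr /znleP gs; apply/znleP => k; rewrite zcoefM.
  have r0 := nle_ge0 Habs (fr 0%N); have s0 := nle_ge0 Habs (gs 0%N).
  apply: (nle_sum Habs H) => [|i _]; first exact: mulr_ge0.
  exact: (nleM H).
- move=> al; rewrite /zmcoef zcoef1; case: eqP => _; first exact: (tl_one H).
  by rewrite (cf0 H) (abs0 Habs).
- move=> a b f al; rewrite /zmcoef zcoef_monomM.
  have -> : mnle b al = (b None <= al None)%N && mnle [ffun i => b (Some i)] [ffun i => al (Some i)].
    apply/forallP/andP => [le_b|[le0 /forallP le1] [i|]] //.
      by split=> //; apply/forallP => i; rewrite !ffunE.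
    by have := le1 i; rewrite !ffunE.
  case: leqP => _ /=; last by rewrite (cf0 H).
  rewrite (tl_term H); case: ifP => // _; congr (_ * coef _ (zcoef f _)).
    by apply/ffunP => i; rewrite !ffunE.
  by rewrite ffunE.
Qed.

Lemma zcoef_sum (J : Type) (s : seq J) (P : pred J) (F : J -> A) k :
  zcoef (\sum_(i <- s | P i) F i) k = \sum_(i <- s | P i) zcoef (F i) k.
Proof. by elim/big_rec2: _ => [|i a f _ <-]. Qed.

Lemma znle_trans f r s : r <= s -> znle f r -> znle f s.
Proof. by move=> rs H k; apply: nle_trans rs (H k). Qed.
Lemma znleD f g r : znle f r -> znle g r -> znle (f + g) r.
Proof. by case: HS => t H fr gr k; apply: (nleD Habs H). Qed.
Lemma znle_sum (J : Type) (s : seq J) (P : pred J) (F : J -> A) r :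
  0 <= r -> (forall i, P i -> znle (F i) r) -> znle (\sum_(i <- s | P i) F i) r.
Proof.
case: HS => t H r0 Fr k; rewrite zcoef_sum; apply: (nle_sum Habs H) => // i Pi.
exact: Fr.
Qed.
Lemma znleM f g r s : znle f r -> znle g s -> znle (f * g) (r * s).
Proof.
by move=> /znleP fr /znleP gs; apply/znleP; case: zseries_tatelike => t H; apply: (nleM H).
Qed.
Lemma znleC a r : nle a r -> znle (zC a) r.
Proof.
case: HS => t H ar k; rewrite zcoefC; case: eqP => // _.
by apply: (nle0 Habs H); apply: nle_ge0 ar.
Qed.
Lemma znleX : znle zX 1.
Proof.
case: HS => t H k; rewrite /=; case: eqP => _; first exact: (nle1 Habs HT).
exact: (nle0 Habs H).
Qed.
Lemma znle_bounded f : exists2 r, 0 < r & znle f r.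
Proof. by have [r] := null_series_bounded (zcoef_null f); exists r. Qed.

Definition zlin (e : K) : A := zX - zC e%:A.
Lemma zcoef_linM e f k :
  zcoef (zlin e * f) k = (if k is k'.+1 then zcoef f k' else 0) - e *: zcoef f k.
Proof. by rewrite mulrBl zcoefD zcoefN zcoefXM zcoefCM -scalerAl mul1r. Qed.

Lemma nleZ1 e f r : abs e <= 1 -> nle f r -> nle (e *: f) r.
Proof.
move=> e1 fr; apply: nle_trans (nleZ Habs HT e fr).
by rewrite -[leRHS]mul1r; apply: ler_wpM2r => //; apply: nle_ge0 fr.
Qed.

(** Horner's scheme: s_k = sum_i e^i f_(k+i) satisfies s_k = f_k + e s_(k+1), so s_0 is the
    remainder and the s_(k+1) are the coefficients of the quotient; |e| <= 1 bounds them all by the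
    norm of [f]. *)
Lemma zdivision e f : abs e <= 1 -> exists c g,
  f = zC c + zlin e * g /\ forall r, znle f r -> nle c r /\ znle g r.
Proof.
case: HS => t H e1.
have eX k : abs (e ^+ k) <= 1 by rewrite (absX Habs) exprn_ile1 ?(abs_ge0 Habs).
have /choice[s Hs] k : exists s, forall N r, (forall i, (N <= i)%N -> nle (e ^+ i *: zcoef f (k + i)) r) ->
    nle (s - \sum_(i < N) e ^+ i *: zcoef f (k + i)) r.
  apply: (tl_sum Habs H) => eps /(zcoef_null f)[N HN]; exists N => i le_i.
  by apply: nleZ1 => //; apply: HN; lia.
have sb k r : (forall i, (k <= i)%N -> nle (zcoef f i) r) -> nle (s k) r.
  move=> fr; have := Hs k 0%N r; rewrite big_ord0 subr0; apply=> i _.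
  by apply: nleZ1 => //; apply: fr; lia.
have srec k : s k = zcoef f k + e *: s k.+1.
  apply/eqP; rewrite -subr_eq0; apply/eqP; apply: (nle_small_eq0 Habs H) => eps eps0.
  have [N HN] := zcoef_null f eps0.
  have T1 := Hs k N.+1 eps; have T2 := Hs k.+1 N eps.
  have -> : s k - (zcoef f k + e *: s k.+1) =
      (s k - \sum_(i < N.+1) e ^+ i *: zcoef f (k + i)) -
      e *: (s k.+1 - \sum_(i < N) e ^+ i *: zcoef f (k.+1 + i)).
    rewrite big_ord_recl expr0 scale1r addn0 /=.
    have -> : \sum_(i < N) e ^+ bump 0 i *: zcoef f (k + bump 0 i) =
        e *: \sum_(i < N) e ^+ i *: zcoef f (k.+1 + i).
      rewrite scaler_sumr; apply: eq_bigr => i _; rewrite scalerA -exprS.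
      by rewrite /bump /= add1n addnS.
    rewrite scalerBr; set u := e *: s _; set v := e *: _; set w := zcoef f k; ring.
  apply: (nleB Habs H); last (apply: nleZ1 => //).
    by apply: T1 => i le_i; apply: nleZ1 => //; apply: HN; lia.
  by apply: T2 => i le_i; apply: nleZ1 => //; apply: HN; lia.
have ns : null_series (fun k => s k.+1).
  move=> eps /(zcoef_null f)[N HN]; exists N => k le_k; apply: sb => i le_i; apply: HN; lia.
exists (s 0%N), (mkz ns); split=> [|r fr].
  apply: zext => -[|k]; rewrite zcoefD zcoef_linM zcoefC /= srec; first by rewrite add0r addrK.
  by rewrite add0r addrK.
by split=> [|k]; apply: sb => i _.
Qed.

(** Comparing coefficients gives g_k = e g_(k+1), hence g_k = e^N g_(k+N), which tends to 0. This is
    the uniqueness of the remainder modulo z - e. *)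
Lemma zlin_const e c g : abs e <= 1 -> zC c = zlin e * g -> c = 0 /\ g = 0.
Proof.
case: HS => t H e1 E.
have rec k : zcoef g k = e *: zcoef g k.+1.
  have := congr1 (fun f => zcoef f k.+1) E; rewrite zcoef_linM zcoefC /=.
  by move/eqP; rewrite eq_sym subr_eq0 => /eqP.
have g0 k : zcoef g k = 0.
  apply: (nle_small_eq0 Habs H) => eps /(zcoef_null g)[N HN].
  have -> : zcoef g k = e ^+ N *: zcoef g (N + k).
    elim: N {HN} => [|N ->]; first by rewrite expr0 scale1r.
    by rewrite [in LHS]rec scalerA -exprSr.
  apply: nleZ1; last by apply: HN; lia.
  by rewrite (absX Habs) exprn_ile1 ?(abs_ge0 Habs).
split; last exact: zext.
have := congr1 (fun f => zcoef f 0%N) E.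
by rewrite zcoef_linM zcoefC /= g0 scaler0 subrr.
Qed.

Lemma zlin_reg e f g : abs e <= 1 -> zlin e * f = zlin e * g -> f = g.
Proof.
move=> e1 E; apply/eqP; rewrite -subr_eq0; apply/eqP.
apply: (zlin_const (c := 0) e1 _).2.
by rewrite raddf0 mulrBr E subrr.
Qed.

(** The value at [e] is defined as the remainder modulo z - e; additivity and multiplicativity
    follow from its uniqueness, with no rearrangement of series. *)
Lemma zeval_exists e : abs e <= 1 -> exists phi : {rmorphism A -> S},
  [/\ forall c, phi (zC c) = c, forall f, exists g, f = zC (phi f) + zlin e * g /\
       forall r, znle f r -> znle g r & forall f r, znle f r -> nle (phi f) r].
Proof.
move=> e1; have /choice[phi Hphi] f : exists c, exists g,
    f = zC c + zlin e * g /\ forall r, znle f r -> nle c r /\ znle g r by apply: zdivision.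
have uniq f c g : f = zC c + zlin e * g -> phi f = c.
  move=> E; have [g' [E' _]] := Hphi f; apply/eqP; rewrite -subr_eq0; apply/eqP.
  apply: (zlin_const (g := g - g') e1 _).1.
  rewrite (raddfB zC) mulrBr.
  have H : zC (phi f) + zlin e * g' = zC c + zlin e * g by rewrite -E'.
  by apply/eqP; rewrite subr_eq eq_sym addrAC subr_eq addrC eq_sym; apply/eqP.
have phiB : zmod_morphism phi.
  move=> f f'; have [g [E _]] := Hphi f; have [g' [E' _]] := Hphi f'.
  by apply: (uniq _ _ (g - g')); rewrite raddfB mulrBr {1}E {1}E' opprD addrACA.
have phiM : monoid_morphism phi.
  split; first by apply: (uniq _ _ 0); rewrite mulr0 addr0 rmorph1.
  move=> f f'; have [g [E _]] := Hphi f; have [g' [E' _]] := Hphi f'.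
  apply: (uniq _ _ (zC (phi f) * g' + g * f')).
  have -> : zC (phi f * phi f') = zC (phi f) * zC (phi f') by rewrite (rmorphM zC).
  move: E E'; move: (zC (phi f)) (zC (phi f')) => a a' E ->; rewrite E; ring.
pose m1 := GRing.isZmodMorphism.Build A S phi phiB.
pose m2 := GRing.isMonoidMorphism.Build A S phi phiM.
pose phir : {rmorphism A -> S} := HB.pack phi m1 m2.
exists phir; split=> [c|f|f r fr].
- by apply: (uniq _ _ 0); rewrite mulr0 addr0.
- by have [g [E Hg]] := Hphi f; exists g; split=> // r /Hg[].
- by have [g [E Hg]] := Hphi f; have [] := Hg r fr.
Qed.

End RestrictedSeries.

(** * Ideals of S<z> near a point *)

Section Evaluation.
Variables (R : realType) (K : fieldType) (abs : K -> R).
Hypothesis Habs : nonarch_complete_abs abs.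
Variables (d : nat) (S : comAlgType K) (x : 'I_d -> S) (coef : mon d -> S -> K).
Hypothesis HT : is_Tate_algebra abs x coef.
Local Notation nle := (nle abs coef).
Local Notation A := (zseries Habs HT).
Local Notation zC := (zC Habs HT).
Local Notation zlin := (zlin Habs HT).

Definition is_evaluation (ev : K -> {rmorphism A -> S}) := forall e, abs e <= 1 ->
  [/\ forall c, ev e (zC c) = c, forall f, exists g, f = zC (ev e f) + zlin e * g /\
       forall r, znle f r -> znle g r & forall f r, znle f r -> nle (ev e f) r].

Lemma evaluation_exists : exists ev, is_evaluation ev.
Proof.
(* Default value at points with [abs e > 1], on which [is_evaluation] imposes nothing. *)
have [phi0 _] : exists phi0 : {rmorphism A -> S}, True.
  have [|phi _] := @zeval_exists _ _ _ Habs _ _ _ _ HT 0; last by exists phi.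
  by rewrite (abs0 Habs).
have /choice[ev Hev] e : exists phi : {rmorphism A -> S}, abs e <= 1 ->
  [/\ forall c, phi (zC c) = c, forall f, exists g, f = zC (phi f) + zlin e * g /\
       forall r, znle f r -> znle g r & forall f r, znle f r -> nle (phi f) r].
  have [e1|] := EM (abs e <= 1); last by exists phi0.
  by have [phi H] := zeval_exists Habs HT e1; exists phi.
by exists ev.
Qed.

Variable ev : K -> {rmorphism A -> S}.
Hypothesis Hev : is_evaluation ev.

Lemma evC e c : abs e <= 1 -> ev e (zC c) = c.
Proof. by case/Hev. Qed.

Lemma ev_le e f r : abs e <= 1 -> znle f r -> nle (ev e f) r.
Proof. by case/Hev => _ _; apply. Qed.

Lemma ev_lin0 e : abs e <= 1 -> ev e (zlin e) = 0.
Proof.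
move=> e1; have [_ /(_ (zlin e))[g [E _]] _] := Hev e1.
apply: (zlin_const (e := e) (g := 1 - g) e1 _).1.
by rewrite mulrBr mulr1 {2}E addrK.
Qed.

Lemma ev_lin e b : abs e <= 1 -> ev e (zlin b) = (e - b)%:A.
Proof.
move=> e1; have -> : zlin b = zlin e + zC (e - b)%:A.
  by rewrite /zlin scalerBl raddfB /= addrA subrK.
by rewrite rmorphD /= ev_lin0 // evC // add0r.
Qed.

Lemma ev_kernel e f : abs e <= 1 -> ev e f = 0 ->
  exists g, f = zlin e * g /\ forall r, znle f r -> znle g r.
Proof.
move=> e1 f0; have [_ /(_ f)[g [E Hg]] _] := Hev e1.
by exists g; split=> //; rewrite {1}E f0 rmorph0 add0r.
Qed.

(** Write f = f(b) + (z - b) g with g no larger than f, and evaluate at [a]. *)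
Lemma ev_dist a b f r : abs a <= 1 -> abs b <= 1 -> znle f r ->
  nle (ev a f - ev b f) (abs (a - b) * r).
Proof.
move=> a1 b1 fr; have [_ /(_ f)[g [E Hg]] _] := Hev b1.
have -> : ev a f - ev b f = (a - b) *: ev a g.
  rewrite {1}E rmorphD rmorphM /= evC // ev_lin // addrC addKr.
  by rewrite -scalerAl mul1r.
by apply: (nleZ Habs HT); apply: ev_le => //; apply: Hg.
Qed.

Section LocalBehaviour.
Variable I : A -> Prop.
Hypotheses (I0 : I 0) (ID : forall f g, I f -> I g -> I (f + g)) (IM : forall f g, I g -> I (f * g)).
Variable a : K.
Hypothesis a1 : abs a <= 1.

(** Saturation removes the vanishing at [a] that is due only to powers of z - a. At [b <> a] it
    leaves the image unchanged, z - a being invertible there. *)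
Let sat f := exists m, I (zlin a ^+ m * f).
Let satD f g : sat f -> sat g -> sat (f + g).
Proof.
move=> [m Hm] [n Hn]; exists (m + n)%N; rewrite mulrDr; apply: ID; rewrite exprD.
  by rewrite mulrAC mulrC; apply: IM.
by rewrite -mulrA; apply: IM.
Qed.
Let satM f g : sat g -> sat (f * g).
Proof. by move=> [m Hm]; exists m; rewrite mulrCA; apply: IM. Qed.
Let sat0 : sat 0.
Proof. by exists 0%N; rewrite mulr0. Qed.

Let J s := exists f, sat f /\ ev a f = s.

Lemma unit_nearby : J 1 -> exists2 eta, 0 < eta & forall b, abs b <= 1 -> b <> a ->
  abs (b - a) < eta -> exists f, I f /\ ev b f = 1.
Proof.
move=> [f [[m If] f1]]; have [r r0 fr] := znle_bounded f.
(* As [f] has norm at most [r], this radius keeps [ev b f] at distance less than 1 from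
   [ev a f = 1], hence a unit. *)
exists r^-1 => [|b b1 nba lt_ba]; first by rewrite invr_gt0.
have [t HS] := Tate_tatelike Habs HT.
have [||v Hv] := one_sub_inv Habs HS (w := 1 - ev b f) (q := abs (a - b) * r).
- by rewrite -f1; apply: ev_dist.
- by rewrite -(absN Habs) opprB -ltr_pdivlMr // mul1r.
rewrite opprB addrC subrK in Hv.
(* The constant cancels both (b - a)^m and the unit [ev b f]. *)
exists (zC (v * ((b - a) ^- m)%:A) * (zlin a ^+ m * f)); split; first exact: IM.
have ba0 : (b - a) ^+ m != 0 by rewrite expf_neq0 // subr_eq0; apply/eqP.
rewrite (rmorphM (ev b)) (rmorphM (ev b) (_ ^+ _)) rmorphXn /= evC // ev_lin //.
have -> : (b - a)%:A ^+ m = ((b - a) ^+ m)%:A :> S by rewrite exprZn expr1n.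
have P : ((b - a) ^- m)%:A * ((b - a) ^+ m)%:A = 1 :> S.
  by rewrite -scalerAl mul1r scalerA mulVf // scale1r.
by rewrite -mulrA [X in v * X]mulrA P mul1r mulrC.
Qed.

(* A lift [v] of 1 at [b] is replaced by one of norm at most
   [max C (|b - a| C |v|)]: divide [ev a v] in [J], lift the division, and
   evaluate the multiple [zlin a * v1] left over at [b] instead of [a]. *)
Lemma non_unit_nearby : ~ J 1 -> exists2 eta, 0 < eta & forall b, abs b <= 1 ->
  abs (b - a) < eta -> ~ exists f, I f /\ ev b f = 1.
Proof.
move=> nJ1; have [t HS] := Tate_tatelike Habs HT.
have [|k [g [Jg Hg]]] := @bounded_division _ _ _ Habs _ _ _ _ HS 1 1 (fun X => J (X ord0 ord0)).
  split.
  - by exists 0; rewrite mxE rmorph0.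
  - move=> X Y [f [sf fX]] [f' [sf' fY]]; exists (f + f'); rewrite mxE rmorphD fX fY.
    by split=> //; apply: satD.
  - move=> s X [f [sf fX]]; exists (zC s * f); rewrite mxE rmorphM /= evC // fX.
    by split=> //; apply: satM.
have /choice[u Hu] j := Jg j.
have /choice[b0 Hb0] j : exists r, 0 < r /\ znle (u j) r.
  by have [r] := znle_bounded (u j); exists r.
(* [C] bounds the norms of the chosen lifts [u j] of the generators of [J]. The radius 1/C then
   makes the ratio [th] less than 1. *)
pose C := 1 + \sum_j b0 j.
have C1 : 1 <= C by rewrite lerDl sumr_ge0 // => j _; apply: ltW; case: (Hb0 j).
have C0 : 0 < C by apply: lt_le_trans C1.
have uC j : znle (u j) C.
  have [_] := Hb0 j; apply: znle_trans; rewrite /C (bigD1 j) //= addrCA lerDl.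
  by apply: addr_ge0 => //; apply: sumr_ge0 => i _; apply: ltW; case: (Hb0 i).
exists C^-1 => [|b b1 lt_ba]; first by rewrite invr_gt0.
move=> [f [If f1]]; have [L L0 fL] := znle_bounded f.
pose th := abs (b - a) * C.
have th0 : 0 <= th by rewrite mulr_ge0 ?(abs_ge0 Habs) // ltW.
have th1 : th < 1 by rewrite -ltr_pdivlMr // mul1r.
have eth : abs (b - a) <= th by rewrite ler_peMr // (abs_ge0 Habs).
(* A lift of 1 of norm at most [C] has at [a] a value within [th] of 1, so a unit in [J], against
   [~ J 1]. What remains is to bring the norm down from [L] to [C]. *)
suff [v [sv vb vC]] : exists v, [/\ sat v, ev b v = 1 & znle v C].
  have [|w Hw] := one_sub_inv Habs HS (w := 1 - ev a v) (q := th) _ th1.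
    by rewrite -vb; apply: ev_dist.
  rewrite opprB addrC subrK in Hw; apply: nJ1; exists (zC w * v); split; first exact: satM.
  by rewrite rmorphM /= evC // mulrC.
have [|n Hn] := geometric_small (q := th) L _ C0; first by rewrite th0.
suff [v [sv vb vC]] : exists v, [/\ sat v, ev b v = 1 & znle v (Num.max C (L * th ^+ n))].
  exists v; split=> //; apply: znle_trans vC; by rewrite ge_max lexx Hn.
elim: n {Hn} => [|n [v [sv vb]]].
  exists f; split=> //; first by exists 0%N; rewrite mul1r.
  by apply: znle_trans fL; rewrite expr0 mulr1 le_max lexx orbT.
set M := Num.max _ _ => vM; set M' := Num.max _ _.
have CM : C <= M by rewrite le_max lexx.
have M0 : 0 < M by apply: lt_le_trans CM.
have thM : th * M <= M'.
  rewrite maxr_pMr // ge_max !le_max; apply/andP; split; apply/orP; [left|right].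
    by apply: ler_piMl; apply: ltW.
  by rewrite exprS mulrCA.
have CM' : C <= M' by rewrite le_max lexx.
(* [v] is 1 at [b], so its value at [a] has norm at most [r0]. *)
pose r0 := Num.max 1 (abs (b - a) * M).
have r0C : r0 * C <= M'.
  by rewrite maxr_pMl ?(ltW C0) // mul1r ge_max CM' mulrAC.
have r0M : r0 * C <= M.
  rewrite maxr_pMl ?(ltW C0) // mul1r ge_max CM mulrAC; apply: ler_piMl; exact: ltW.
have avr : nle (ev a v) r0.
  rewrite -[ev a v](subrK (ev b v)) vb; apply: (nleD Habs HS).
    have : nle (ev a v - ev b v) (abs (a - b) * M) by apply: ev_dist.
    rewrite vb -(absN Habs) opprB; apply: nle_trans; by rewrite le_max lexx orbT.
  by apply: nle_trans (nle1 Habs HT); rewrite le_max lexx.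
have [|||h [hr Eh]] := Hg (const_mx (ev a v)) r0.
- by apply: lt_le_trans ltr01 _; rewrite le_max lexx.
- by rewrite mxE; exists v.
- by move=> i j; rewrite mxE.
have {}Eh : ev a v = \sum_j h j * ev a (u j).
  move/matrixP/(_ ord0 ord0): Eh; rewrite mxE summxE => ->.
  by apply: eq_bigr => j _; rewrite mxE; have [_ ->] := Hu j.
pose W := \sum_j zC (h j) * u j.
have sW : sat W.
  by apply: big_ind => // j _; apply: satM; case: (Hu j).
have WC : znle W (r0 * C).
  apply: znle_sum => [|j _]; last by apply: znleM => //; apply: znleC.
  by rewrite mulr_ge0 ?(ltW C0) // le_max ler01.
have Wa : ev a W = ev a v.
  by rewrite rmorph_sum Eh; apply: eq_bigr => j _; rewrite rmorphM /= evC.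
have [||v1 [Ev1 Hv1]] := ev_kernel (e := a) (f := v - W) => //.
  by rewrite rmorphB /= Wa subrr.
have v1M : znle v1 M.
  apply: Hv1; rewrite -mulN1r; apply: znleD => //; rewrite -[M]mul1r; apply: znleM.
    move=> i; rewrite zcoefN; apply: (nleN Habs HS); rewrite zcoef1; case: eqP => _.
      exact: (nle1 Habs HT).
    exact: (nle0 Habs HS).
  exact: znle_trans r0M WC.
have sv1 : sat v1.
  have : sat (v - W) by apply: satD => //; rewrite -mulN1r; apply: satM.
  by rewrite Ev1 => -[m Hm]; exists m.+1; rewrite exprSr -mulrA.
exists (W + zC (b - a)%:A * v1); split.
- by apply: satD => //; apply: satM.
- rewrite rmorphD rmorphM /= evC // -ev_lin // -rmorphM -rmorphD /= -Ev1.
  by rewrite addrC subrK.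
- apply: znleD; first exact: znle_trans r0C WC.
  apply: znle_trans (_ : abs (b - a) * M <= _) _; first by apply: le_trans thM; apply: ler_wpM2r => //; apply: ltW.
  apply: znleM => //; apply: znleC; rewrite -[abs _]mulr1; apply: (nleZ Habs HT).
  exact: (nle1 Habs HT).
Qed.

Lemma local_dichotomy : exists2 eta, 0 < eta &
  (forall b, abs b <= 1 -> b <> a -> abs (b - a) < eta -> exists f, I f /\ ev b f = 1) \/
  (forall b, abs b <= 1 -> b <> a -> abs (b - a) < eta -> ~ exists f, I f /\ ev b f = 1).
Proof.
have [/unit_nearby[eta e0 H]|/non_unit_nearby[eta e0 H]] := EM (J 1); exists eta => //.
  by left.
by right=> b b1 _; apply: H.
Qed.
End LocalBehaviour.
End Evaluation.

(** * Subsets of Z that are locally constant p-adically *)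

Section Padic.
Variables (R : realType) (K : fieldType) (abs : K -> R) (p : nat).
Hypotheses (Habs : nonarch_complete_abs abs) (pr_p : prime p) (abs_p : abs p%:R = (p%:R)^-1).

Let p0 : (0 : R) < p%:R. Proof. by rewrite ltr0n prime_gt0. Qed.
Let p1 : (1 : R) < p%:R. Proof. by rewrite ltr1n prime_gt1. Qed.

Lemma abs_nat_le1 n : abs n%:R <= 1.
Proof.
elim: n => [|n IH]; first by rewrite (abs0 Habs) ler01.
by rewrite -natr1; apply: (abs_leD Habs) => //; rewrite (abs1 Habs).
Qed.

Lemma abs_int_le1 (n : int) : abs n%:~R <= 1.
Proof.
by case: n => n; rewrite ?NegzE ?mulrNz ?(absN Habs); apply: abs_nat_le1.
Qed.

(** Only |p| is prescribed. For m prime to p, |m| < 1 is excluded by Bezout: 1 would be a difference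
    of multiples of m and of p, both of absolute value below 1. *)
Lemma abs_natE n : (0 < n)%N -> abs n%:R = p%:R ^- logn p n.
Proof.
move=> n0; have [m cop {1}->] := pfactor_coprime pr_p n0.
rewrite natrM natrX (absM Habs) (absX Habs) abs_p exprVn.
suff -> : abs m%:R = 1 by rewrite mul1r.
apply/eqP; rewrite eq_le abs_nat_le1 leNgt; apply/negP => lt1.
case: m cop lt1 => [|m] cop lt1.
  by move: cop; rewrite /coprime gcdn0 => /eqP p_1; move: p1; rewrite p_1 ltxx.
have [km kn E _] := @egcdnP m.+1 p isT.
have : abs (km * m.+1)%:R < 1.
  rewrite natrM (absM Habs); apply: le_lt_trans lt1.
  by rewrite -[leRHS]mul1r; apply: ler_wpM2r; [exact: (abs_ge0 Habs)|exact: abs_nat_le1].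
move: cop; rewrite coprime_sym /coprime => /eqP cop.
have : abs (kn * p)%:R < 1.
  rewrite natrM (absM Habs) abs_p; apply: le_lt_trans (_ : p%:R^-1 < 1); last by rewrite invf_lt1.
  by rewrite -[leRHS]mul1r; apply: ler_wpM2r; [rewrite invr_ge0 ltW|exact: abs_nat_le1].
move=> l1; rewrite E cop natrD -[_ + _]opprK opprD => l2.
have := abs_ltD Habs l1 (_ : abs (- (kn * p)%:R - 1) < 1).
rewrite addrA subrr sub0r !(absN Habs) (abs1 Habs) ltxx => H; suff: false by [].
by apply: H; rewrite -(absN Habs).
Qed.

Lemma char0 (n : int) : n != 0 -> n%:~R != 0 :> K.
Proof.
have nat0 m : (0 < m)%N -> m%:R != 0 :> K.
  move=> m0; apply/eqP => /(abs_eq0 Habs); rewrite abs_natE // => /eqP.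
  by rewrite invr_eq0 expf_eq0 gt_eqF ?andbF.
case: n => n n0; first by apply: nat0; rewrite lt0n.
by rewrite NegzE mulrNz oppr_eq0; apply: nat0.
Qed.

Lemma abs_dvd k (n : int) : ((p ^ k)%N %| n)%Z -> abs n%:~R <= p%:R ^- k.
Proof.
move=> /dvdzP[m ->]; rewrite intrM (absM Habs) -pmulrn natrX (absX Habs) abs_p exprVn.
rewrite -[leRHS]mul1r; apply: ler_wpM2r; last exact: abs_int_le1.
by rewrite invr_ge0 exprn_ge0 // ltW.
Qed.

Lemma inv_pow_small (e : R) : 0 < e -> exists k, p%:R ^- k < e.
Proof.
move=> e0; have [||N HN] := @geometric_small R p%:R^-1 1 (e / 2).
- by rewrite invr_ge0 ltW //= invf_lt1.
- exact: divr_gt0.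
by exists N; have := HN N (leqnn _); rewrite mul1r exprVn; lra.
Qed.

Lemma inv_pow_mono k l : (k <= l)%N -> p%:R ^- l <= p%:R ^- k :> R.
Proof. by move=> le_kl; rewrite lef_pV2 ?posrE ?exprn_gt0 // ler_eXn2l. Qed.

Variable P : int -> Prop.
Hypothesis P_local : forall a : K, abs a <= 1 -> exists2 eta, 0 < eta &
  (forall n : int, n%:~R <> a -> abs (n%:~R - a) < eta -> P n) \/
  (forall n : int, n%:~R <> a -> abs (n%:~R - a) < eta -> ~ P n).

Let good k (c : int) := exists r (E : seq int), forall n n', n \notin E -> n' \notin E ->
  ((p ^ k)%N %| n - c)%Z -> ((p ^ k)%N %| n' - c)%Z -> ((p ^ r)%N %| n - n')%Z -> (P n <-> P n').

(** If all [p] subclasses modulo p^(k+1) are good, the union of their exceptional sets and the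
    largest of their moduli serve the whole class; taking the modulus at least p^(k+1) puts [n] and
    [n'] in the same subclass. *)
Let bad_refine k c : ~ good k c -> exists c', ((p ^ k)%N %| c' - c)%Z /\ ~ good k.+1 c'.
Proof.
move=> bad; apply: contrapT => none; apply: bad.
have /choice[r Hr] (j : 'I_p) : good k.+1 (c + j%:Z * (p ^ k)%N%:Z).
  apply: contrapT => bad; apply: none; exists (c + j%:Z * (p ^ k)%N%:Z); split=> //.
  by rewrite addrC addKr dvdz_mull.
have /choice[E HE] := Hr.
exists (maxn k.+1 (\max_j r j)), (flatten [seq E j | j <- enum 'I_p]) => n n' nE n'E dn dn' dnn'.
have dk : ((p ^ k.+1)%N %| n - n')%Z.
  by apply: dvdz_trans dnn'; rewrite dvdzE /= dvdn_exp2l ?leq_maxl.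
have /dvdzP[q nE'] := dn.
have pz0 : p%:Z != 0 by rewrite -lt0n prime_gt0.
have lt_j : (`|(q %% p%:Z)%Z| < p)%N.
  have := ltz_pmod q (_ : 0 < p%:Z); rewrite ltz_nat prime_gt0 // => /(_ isT).
  by have := modz_ge0 q pz0; case: (q %% p)%Z.
pose j := Ordinal lt_j.
have jE : j%:Z = (q %% p%:Z)%Z by rewrite /= gez0_abs // modz_ge0.
have dj : ((p ^ k.+1)%N %| n - (c + j%:Z * (p ^ k)%N%:Z))%Z.
  rewrite opprD addrA nE' jE -mulrBl {1}(divz_eq q p) addrK -mulrA -PoszM -expnS.
  exact: dvdz_mull.
apply: (HE j) => //.
- by apply: contra nE => nEj; apply/flatten_mapP; exists j; rewrite ?mem_enum.
- by apply: contra n'E => nEj; apply/flatten_mapP; exists j; rewrite ?mem_enum.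
- have -> : n' - (c + j%:Z * (p ^ k)%N%:Z) = (n - (c + j%:Z * (p ^ k)%N%:Z)) - (n - n') by ring.
  exact: rpredB.
- by apply: dvdz_trans dnn'; rewrite dvdzE /= dvdn_exp2l // leq_max leq_bigmax orbT.
Qed.

(** A Koenig argument: nested bad classes have centres converging to some [l] in K. Near [l] the set
    is constant except possibly at [l], which makes a late class good. *)
Let good_all : good 0 0.
Proof.
apply: contrapT => bad0.
have /choice[nxt Hn] (kc : nat * int) : exists c', ~ good kc.1 kc.2 ->
    ((p ^ kc.1)%N %| c' - kc.2)%Z /\ ~ good kc.1.+1 c'.
  have [/bad_refine[c' H]|g] := EM (~ good kc.1 kc.2); first by exists c'.
  by exists 0 => /g.
pose cs := fix cs k := if k is k'.+1 then nxt (k', cs k') else 0.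
have bad k : ~ good k (cs k) by elim: k => //= k IH; have [] := Hn (k, cs k) IH.
have dcs k : ((p ^ k)%N %| cs k.+1 - cs k)%Z by have [] := Hn (k, cs k) (bad k).
have [|l Hl] := @null_sum _ _ _ Habs (fun k => (cs k.+1 - cs k)%:~R).
  move=> e /inv_pow_small[N HN]; exists N => k le_k.
  apply: le_trans (abs_dvd (dcs k)) _; apply: le_trans (inv_pow_mono le_k) _; exact: ltW.
have la k : abs (l - (cs k)%:~R) <= p%:R ^- k.
  have := Hl k (p%:R ^- k) (fun i le_i => le_trans (abs_dvd (dcs i)) (inv_pow_mono le_i)).
  have -> // : \sum_(i < k) (cs i.+1 - cs i)%:~R = (cs k)%:~R :> K.
  by elim: k => [|k IH]; rewrite ?big_ord0 // big_ord_recr IH /= -intrD addrC subrK.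
have l1 : abs l <= 1 by have := la 0%N; rewrite subr0 expr0 invr1.
have [eta eta0 H] := P_local l1; have [k Hk] := inv_pow_small eta0.
have near n : ((p ^ k)%N %| n - cs k)%Z -> abs (n%:~R - l) < eta.
  move=> /abs_dvd le_n; apply: le_lt_trans Hk.
  rewrite -[_ - l](subrKA (cs k)%:~R) -intrB -[_ - l]opprB; exact: (abs_leB Habs).
apply: (bad k); exists 0%N.
(* In characteristic 0 at most one integer maps to [l], so the puncture costs one exception. *)
have [E HE] : exists E : seq int, forall n, n \notin E -> n%:~R <> l.
  have [[n0 E0]|none] := EM (exists n0 : int, n0%:~R = l); last first.
    by exists [::] => n _ E; apply: none; exists n.
  exists [:: n0] => n; rewrite inE => ne E; have : (n - n0)%:~R = 0 :> K.
    by rewrite intrB E E0 subrr.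
  by apply/eqP; apply: char0; rewrite subr_eq0.
exists E => n n' /HE nl /HE n'l dn dn' _.
have Hn1 := near n dn; have Hn2 := near n' dn'.
case: H => H; first by split=> _; apply: H.
by split=> Pn; [case: (H n nl Hn1)|case: (H n' n'l Hn2)].
Qed.

Lemma ae_union_of_local : exists r, ae_union_of_APs (p ^ r) P.
Proof.
have [r [E HE]] := good_all; exists r.
(* A class is kept when some non-exceptional member satisfies [P]; by [HE] all its non-exceptional
   members then do. *)
pose Q (j : nat) := exists n : int, [/\ n \notin E, P n & (n = j%:Z %[mod (p ^ r)%N])%Z].
exists [seq j%:Z | j <- iota 0 (p ^ r) & `[< Q j >]], E => n nE.
have q0 : (p ^ r)%N%:Z != 0 by rewrite -lt0n expn_gt0 prime_gt0.
split=> [Pn|[a /mapP[j]]].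
  have m0 := modz_ge0 n q0.
  have lt_m := ltz_pmod n (_ : 0 < (p ^ r)%N%:Z); rewrite ltz_nat expn_gt0 prime_gt0 // in lt_m.
  have {lt_m} lt_m := lt_m isT.
  have mE : `|(n %% (p ^ r)%N)%Z|%N%:Z = (n %% (p ^ r)%N)%Z by rewrite gez0_abs.
  exists `|(n %% (p ^ r)%N)%Z|%N%:Z; last by rewrite mE modz_mod.
  apply: map_f; rewrite mem_filter mem_iota /= add0n -ltz_nat mE lt_m andbT.
  by apply/asboolP; exists n; split=> //; rewrite mE modz_mod.
rewrite mem_filter => /andP[/asboolP[n' [n'E Pn' En']] _] -> En.
apply/(HE n n') => //; rewrite ?subr0 ?dvd1z //.
by rewrite -eqz_mod_dvd; apply/eqP; rewrite En En'.
Qed.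
End Padic.

(** * Interpolation of the iterates *)

(** Legendre's bound v_p(n!) <= n/(p-1), the origin of the threshold for [c]. *)
Lemma logn_fact_le p n : prime p -> ((p - 1) * logn p n`! <= n)%N.
Proof.
move=> pr_p; rewrite logn_fact //.
(* The extra term floor(n/p^m) makes the sum telescope, because (p-1)q + q = pq. *)
suff H m : ((p - 1) * (\sum_(1 <= k < m.+1) n %/ p ^ k) + n %/ p ^ m <= n)%N.
  by apply: leq_trans (H n); apply: leq_addr.
elim: m => [|m IH]; first by rewrite big_geq // muln0 expn0 divn1.
rewrite big_nat_recr //= mulnDr -addnA.
have -> : ((p - 1) * (n %/ p ^ m.+1) + n %/ p ^ m.+1 = n %/ p ^ m %/ p * p)%N.
  by rewrite -mulSnr -addn1 subnK ?prime_gt0 // expnSr divnMA mulnC.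
by apply: leq_trans IH; rewrite leq_add2l leq_trunc_div.
Qed.

Section Interpolation.
Variables (R : realType) (p : nat) (K : fieldType) (abs : K -> R).
Hypotheses (pr_p : prime p) (Habs : nonarch_complete_abs abs) (abs_p : abs p%:R = (p%:R)^-1).
Variables (d : nat) (S : comAlgType K) (x : 'I_d -> S) (coef : mon d -> S -> K).
Hypothesis HT : is_Tate_algebra abs x coef.
Local Notation nle := (nle abs coef).

Lemma nle_all_eq0 f : nle f 0 -> f = 0.
Proof.
have [t HS] := Tate_tatelike Habs HT.
by move=> f0; apply: (nle_small_eq0 Habs HS) => e e0; apply: nle_trans (ltW e0) f0.
Qed.

Section Endomorphism.
Variable s : S -> S.
Hypotheses (sD : forall f g, s (f + g) = s f + s g) (sM : forall f g, s (f * g) = s f * s g)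
  (s1 : s 1 = 1) (sZ : forall (a : K) f, s (a *: f) = a *: s f).

Lemma endo0 : s 0 = 0. Proof. by rewrite -[X in s X](scale0r (0 : S)) sZ scale0r. Qed.
Lemma endoN f : s (- f) = - s f. Proof. by rewrite -[X in s X]scaleN1r sZ scaleN1r. Qed.
Lemma endo_sum (J : Type) (r : seq J) (P : pred J) F :
  s (\sum_(i <- r | P i) F i) = \sum_(i <- r | P i) s (F i).
Proof. exact: (big_morph s sD endo0). Qed.

(* For [|c| > |f|] the element [c - f], hence also [c - s f], is a unit; if
   [|s f| > |f|] then some such [c - s f] has no dominant constant term. *)
Lemma endo_contractive f r : nle f r -> nle (s f) r.
Proof.
have [t HS] := Tate_tatelike Habs HT.
move=> fr be; rewrite leNgt; apply/negP => lt_r.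
have r0 := nle_ge0 Habs fr.
pose g := s f.
have [|[[z z'] mu] [nz le_mu _]] := @exists_leading _ _ _ Habs _ _ _ _ HS 1 1 (const_mx g).
  move=> /matrixP/(_ ord0 ord0); rewrite !mxE => g0; move: lt_r.
  by rewrite -/g g0 (tcoef0 HT) (abs0 Habs) ltNge r0.
rewrite /mxcf mxE /= in nz.
have {}le_mu al : abs (coef al g) <= abs (coef mu g).
  by have := le_mu (z, z', al); rewrite /mxcf !mxE.
have lt_rmu : r < abs (coef mu g) by apply: lt_le_trans lt_r (le_mu be).
have a0 : 0 < abs (coef mu g) by apply: le_lt_trans lt_rmu.
have unit c : c != 0 -> abs c = abs (coef mu g) -> forall al, al <> mon0 d ->
    abs (coef al (1 - c^-1 *: g)) < abs (coef (mon0 d) (1 - c^-1 *: g)).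
  move=> c0 Ec; have [||v Hv] := one_sub_inv Habs HS (w := c^-1 *: f) (q := abs c^-1 * r).
  - exact: (nleZ Habs HT).
  - by rewrite (absV Habs) Ec mulrC ltr_pdivrMr ?mul1r.
  apply: (unit_const_dominant Habs HT (v := s v)).
  by have := congr1 s Hv; rewrite sM sD endoN sZ s1.
(* If the constant coefficient of [g] has maximal size, take it for c: then 1 - g/c has constant
   term 0, so this unit would be 0. Otherwise take the coefficient at [mu]: then 1 - g/c has
   absolute value 1 at [mu] and at most 1 at the constant term. *)
have [E|nE] := eqVneq (abs (coef (mon0 d) g)) (abs (coef mu g)).
  pose c := coef (mon0 d) g.
  have c0 : c != 0 by apply/eqP => c0; move: a0; rewrite -E -/c c0 (abs0 Habs) ltxx.
  have u0 : coef (mon0 d) (1 - c^-1 *: g) = 0.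
    by rewrite (cfB HS) (tcoef1 HT) eqxx (tcoefZ HT) mulVf // subrr.
  have all0 al : coef al (1 - c^-1 *: g) = 0.
    have [-> //|/eqP nal] := eqVneq al (mon0 d).
    by have := unit c c0 E al nal; rewrite u0 (abs0 Habs) ltNge (abs_ge0 Habs).
  have [||v Hv] := one_sub_inv Habs HS (w := c^-1 *: f) (q := abs c^-1 * r).
  - exact: (nleZ Habs HT).
  - by rewrite (absV Habs) E mulrC ltr_pdivrMr ?mul1r.
  have := congr1 s Hv; rewrite sM sD endoN sZ s1 -/g (tl_inj HS all0) mul0r => /eqP.
  by rewrite eq_sym oner_eq0.
have nmu : mu <> mon0 d by move=> E; case/eqP: nE; rewrite E.
have {}nz : coef mu g != 0 by apply/eqP.
have := unit (coef mu g) nz erefl mu nmu.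
rewrite !(cfB HS) !(tcoef1 HT) !(tcoefZ HT) eqxx mulVf //.
case: eqP => // _; rewrite sub0r (absN Habs) (abs1 Habs) ltNge => /negP; apply.
apply: (abs_leB Habs); first by rewrite (abs1 Habs).
by rewrite (absM Habs) (absV Habs) mulrC ler_pdivrMr // mul1r.
Qed.

Variable rho : R.
Hypotheses (rho0 : 0 < rho) (x_rho : forall j, nle (s (x j) - x j) rho).

(** The monomials come from surjectivity of the coefficient map; the recursion through [x j] is what
    permits induction on the degree. *)
Lemma monomials_exist : exists X : mon d -> S,
  [/\ forall b al, coef al (X b) = (al == b)%:R, X (mon0 d) = 1 &
      forall (b : mon d) j, (0 < b j)%N -> X b = x j * X (mnsub b (mon_unit j))].
Proof.
have [t HS] := Tate_tatelike Habs HT.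
have /choice[X HX] b := coef_single Habs HT b 1.
have HX1 b al : coef al (X b) = (al == b)%:R by rewrite HX mulr1.
have ext f g : (forall al, coef al f = coef al g) -> f = g.
  move=> E; apply/eqP; rewrite -subr_eq0; apply/eqP; apply: (tl_inj HS) => al.
  by rewrite (cfB HS) E subrr.
exists X; split=> //; first by apply: ext => al; rewrite HX1 (tcoef1 HT).
move=> b j bj; apply: ext => al.
have [_ [_ [_ [_ [_ [_ Hx]]]]]] := HT.
have Hxj gm : coef gm (x j) = (gm == mon_unit j)%:R * 1 by rewrite Hx mulr1.
rewrite (coef_single_mul HT Hxj) HX1 mul1r HX1.
have le1 e : mnle (mon_unit j) e = (0 < e j)%N.
  apply/forallP/idP => [/(_ j)|ej i]; rewrite ffunE; first by rewrite eqxx.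
  by case: eqP => [->|].
rewrite le1; case: posnP => [al0|alj].
  by case: eqP => // E; move: bj; rewrite -E al0.
congr ((nat_of_bool _)%:R); apply/eqP/eqP => [-> //|/ffunP E].
apply/ffunP => i; have := E i; rewrite !ffunE; case: eqP => [->|]; last by rewrite !subn0.
by move: alj bj; rewrite !subn1; move: (al j) (b j) => [|u] [|v] //= _ _ ->.
Qed.

(** On monomials this is an induction on the degree with the twisted Leibniz rule s(uv) - uv =
    s(u)(s(v) - v) + (s(u) - u)v. In general [f] is a polynomial plus a tail of norm at most
    [rho * r], where contractivity of [s] suffices, so [s] is never interchanged with an infinite
    sum. *)
Lemma delta_le f r : nle f r -> nle (s f - f) (rho * r).
Proof.
have [t HS] := Tate_tatelike Habs HT.
have [X [coefX X0 XM]] := monomials_exist.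
have X1 b : nle (X b) 1.
  by move=> al; rewrite coefX; case: eqP; rewrite ?(abs1 Habs) ?(abs0 Habs).
have x1 j : nle (x j) 1.
  have [_ [_ [_ [_ [_ [_ Hx]]]]]] := HT.
  by move=> al; rewrite Hx; case: eqP; rewrite ?(abs1 Habs) ?(abs0 Habs).
have dX b : nle (s (X b) - X b) rho.
  have [n] := ubnP (mdeg b); elim: n b => // n IH b lt_n.
  have [[j bj]|none] := EM (exists j, (0 < b j)%N); last first.
    have -> : b = mon0 d.
      apply/ffunP => j; rewrite ffunE; apply/eqP; rewrite -leqn0 leqNgt; apply/negP => bj.
      by apply: none; exists j.
    by rewrite X0 s1 subrr; apply: (nle0 Habs HS); apply: ltW.
  rewrite (XM b j bj); set b' := mnsub _ _; rewrite sM.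
  have -> : s (x j) * s (X b') - x j * X b' = s (x j) * (s (X b') - X b') + (s (x j) - x j) * X b'.
    by rewrite mulrBr mulrBl addrA subrK.
  apply: (nleD Habs HS).
    rewrite -[rho]mul1r; apply: (nleM HS); first exact: endo_contractive.
    apply: IH; rewrite ltnS in lt_n; apply: leq_trans lt_n; rewrite /mdeg (bigD1 j) //= [leqRHS](bigD1 j) //=.
    rewrite -addSn leq_add //; first by rewrite !ffunE eqxx subn1 prednK.
    by apply: leq_sum => i _; rewrite !ffunE leq_subr.
  by rewrite -[rho]mulr1; apply: (nleM HS).
move=> fr; have := nle_ge0 Habs fr; rewrite le_eqVlt => /orP[/eqP r0|r0].
  rewrite -r0 in fr *; rewrite (nle_all_eq0 fr) endo0 subrr mulr0; exact: (nle0 Habs HS).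
have rr0 : 0 < rho * r by exact: mulr_gt0.
have [N HN] := tl_null HS f rr0; have [L HL] := finite_degree_lt 'I_d N.
pose P := \sum_(al <- undup L) coef al f *: X al.
have hP : nle (f - P) (rho * r).
  move=> be; rewrite (cfB HS) (cf_sum HS).
  have cP al : coef be (coef al f *: X al) = coef al f * (be == al)%:R by rewrite (tcoefZ HT) coefX.
  have [beL|nbeL] := boolP (be \in undup L).
    rewrite (bigD1_seq be) ?undup_uniq //= cP eqxx mulr1 big1 ?addr0 => [|al /negPf nal].
      by rewrite subrr (abs0 Habs) ltW.
    by rewrite cP eq_sym nal mulr0.
  rewrite big_seq big1 ?subr0 => [|al alL]; last first.
    by rewrite cP; case: eqP => [E|]; rewrite ?mulr0 //; rewrite E alL in nbeL.
  by apply: HN; rewrite leqNgt; apply: contra nbeL => /HL; rewrite mem_undup.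
have -> : s f - f = (s P - P) + (s (f - P) - (f - P)).
  rewrite sD endoN; move: (s f) (s P) => a b; ring.
apply: (nleD Habs HS); last by apply: (nleB Habs HS) => //; apply: endo_contractive.
rewrite endo_sum -sumrB; apply: (nle_sum Habs HS) => [|al _]; first exact: ltW.
rewrite sZ -scalerBr; apply: nle_trans (nleZ Habs HT (coef al f) (dX al)).
by rewrite mulrC; apply: ler_wpM2l; rewrite ?(ltW rho0).
Qed.

Definition delta f := s f - f.

Lemma delta_iter_le f r n : nle f r -> nle (iter n delta f) (rho ^+ n * r).
Proof.
move=> fr; elim: n => [|n IH]; first by rewrite mul1r.
by rewrite exprS -mulrA; apply: delta_le.
Qed.

Lemma newton_expansion f n N : (n < N)%N ->
  iter n s f = \sum_(k < N) 'C(n, k)%:R *: iter k delta f.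
Proof.
elim: n N => [|n IH] [//|N] lt_nN.
  rewrite big_ord_recl bin0 scale1r big1 ?addr0 // => i _.
  by rewrite bin0n scale0r.
rewrite iterS (IH N.+1) 1?ltnW // endo_sum.
have sdelta g : s g = g + delta g by rewrite /delta addrC subrK.
under eq_bigr do rewrite sZ sdelta scalerDr.
rewrite big_split /= big_ord_recl [X in _ + X]big_ord_recr /= (@bin_small n N lt_nN) scale0r addr0.
rewrite -addrA -big_split /= [RHS]big_ord_recl !bin0; congr (_ + _).
by apply: eq_bigr => i _; rewrite /bump /= add1n binS natrD scalerDl.
Qed.
End Endomorphism.
End Interpolation.

Lemma prod_falling (A : comNzRingType) n k :
  \prod_(i < k) (n%:R - i%:R) = (n ^_ k)%:R :> A.
Proof.
elim: k => [|k IH]; first by rewrite big_ord0.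
rewrite big_ord_recr /= IH ffactnSr natrM; have [le_kn|lt_nk] := leqP k n.
  by rewrite natrB.
by rewrite ffact_small // !mul0r.
Qed.

Section AnalyticOrbits.
Variables (R : realType) (p : nat) (K : fieldType) (abs : K -> R).
Hypotheses (pr_p : prime p) (Habs : nonarch_complete_abs abs) (abs_p : abs p%:R = (p%:R)^-1).
Variables (d : nat) (S : comAlgType K) (x : 'I_d -> S) (coef : mon d -> S -> K).
Hypothesis HT : is_Tate_algebra abs x coef.
Local Notation nle := (nle abs coef).
Local Notation A := (zseries Habs HT).
Local Notation zC := (zC Habs HT).
Local Notation zlin := (zlin Habs HT).
Variable ev : K -> {rmorphism A -> S}.
Hypothesis Hev : is_evaluation ev.
Variable c : R.
Hypothesis c_gt : 1 / (p%:R - 1) < c.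

Let p1 : (1 : R) < p%:R. Proof. by rewrite ltr1n prime_gt1. Qed.
Let p0 : (0 : R) < p%:R. Proof. exact: lt_trans ltr01 p1. Qed.

(** w is p^(1/(p-1) - c): Legendre's bound gives |k!|^-1 <= p^(k/(p-1)), and [c_gt] makes the
    exponent negative. *)
Lemma convergence_rate : exists2 w : R, 0 < w < 1 &
  forall k, (p%:R `^ (- c)) ^+ k * (abs k`!%:R)^-1 <= w ^+ k.
Proof.
have pm1 : 0 < p%:R - 1 :> R by rewrite subr_gt0.
pose a : R := 1 / (p%:R - 1) - c.
have a0 : a < 0 by rewrite subr_lt0.
exists (p%:R `^ a).
  rewrite powR_gt0 //= lt_def; apply/andP; split.
    rewrite eq_sym powR_eq1 !negb_or (gt_eqF p1) -leNgt (ltW p0) /=.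
    by rewrite lt_eqF.
  by rewrite -[leRHS](powRr0 p%:R); apply: ler_powR; apply: ltW.
move=> k; rewrite (abs_natE Habs pr_p abs_p) ?fact_gt0 // invrK -!powR_mulrn ?powR_ge0 ?(ltW p0) //.
rewrite -!powRrM -powRD; last by rewrite (gt_eqF p0) implybT.
apply: ler_powR; first exact: ltW.
rewrite /a mulrBl addrC mulNr lerD2r mulrAC ler_pdivlMr // mul1r.
have -> : p%:R - 1 = (p - 1)%:R :> R by rewrite natrB // prime_gt0.
by rewrite -natrM ler_nat mulnC logn_fact_le.
Qed.

Lemma zlin_le e : abs e <= 1 -> znle (zlin e) 1.
Proof.
have [t HS] := Tate_tatelike Habs HT.
move=> e1 k; rewrite zcoefD zcoefN; apply: (nleB Habs HS); first exact: znleX.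
by apply: znleC; apply: (nleZ1 Habs HT) => //; apply: (nle1 Habs HT).
Qed.

Section Orbit.
Variable s : S -> S.
Hypotheses (sD : forall f g, s (f + g) = s f + s g) (sM : forall f g, s (f * g) = s f * s g)
  (s1 : s 1 = 1) (sZ : forall (a : K) f, s (a *: f) = a *: s f).
Hypothesis x_rho : forall j, nle (s (x j) - x j) (p%:R `^ (- c)).

Lemma orbit_interpolation f : exists F : A, forall n : nat, ev n%:R F = iter n s f.
Proof.
have [t HS] := Tate_tatelike Habs HT; have [t' HZ] := zseries_tatelike Habs HT.
have [w /andP[w0 w1] Hw] := convergence_rate.
have [r r0 fr] := nle_bounded Habs HS f.
have nat1 := abs_nat_le1 Habs.
pose D k := iter k (delta s) f.
(* Newton's term binom(z, k) Delta^k f, with z(z-1)...(z-k+1) as a product of linear factors. *)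
pose T k : A := zC (k`!%:R^-1 *: D k) * \prod_(i < k) zlin i%:R.
have Tle k : znle (T k) (r * w ^+ k).
  rewrite -[r * _]mulr1; apply: znleM.
    apply: znleC; apply: nle_trans (nleZ Habs HT (k`!%:R^-1)
      (delta_iter_le Habs HT sD sM s1 sZ (powR_gt0 _ p0) x_rho k fr)).
    rewrite (absV Habs) mulrCA mulrA [_ * r]mulrC; apply: ler_wpM2l; first exact: ltW.
    exact: Hw.
  elim: k => [|k IH]; first by rewrite big_ord0; apply: znleC; exact: (nle1 Habs HT).
  by have := znleM IH (zlin_le (nat1 k)); rewrite big_ord_recr /= mulr1.
have [|F HF] := tl_sum Habs HZ (s := T).
  move=> e e0; have [|N HN] := @geometric_small _ w r e _ e0; first by rewrite ltW.
  by exists N => k /HN le_e; apply/znleP; apply: znle_trans le_e (Tle k).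
exists F => n; apply/eqP; rewrite -subr_eq0; apply/eqP.
apply: (nle_small_eq0 Habs HS) => e e0.
have [|N HN] := @geometric_small _ w r e _ e0; first by rewrite ltW.
(* [N] makes the tail small; [n.+1] makes Newton's finite expansion of the n-th iterate exact. *)
pose M := maxn N n.+1.
have -> : iter n s f = ev n%:R (\sum_(k < M) T k).
  rewrite (newton_expansion sD sZ f (N := M)) ?leq_maxr // rmorph_sum.
  apply: eq_bigr => k _; rewrite rmorphM /= evC // rmorph_prod.
  have -> : \prod_(i < k) ev n%:R (zlin i%:R) = (n ^_ k)%:R.
    rewrite -prod_falling; apply: eq_bigr => i _; rewrite ev_lin //.
    by rewrite scalerBl !scaler_nat.
  rewrite -(scaler_nat _ 1) -scalerAr mulr1 scalerA -bin_ffact natrM mulfK //.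
  by apply: (char0 Habs pr_p abs_p (n := k`!)); rewrite -lt0n fact_gt0.
rewrite -rmorphB; apply: ev_le => //; apply/znleP; apply: HF => k le_k.
apply/znleP; apply: znle_trans (Tle k); apply: HN; apply: leq_trans le_k; exact: leq_maxl.
Qed.
End Orbit.

(** For a negative index -(n+1), let g be the backward iterate of [f] and G its own interpolation.
    Then F(p^k - n - 1) = G(p^k), both being forward iterates of g; as k grows the sides tend to
    F(-n-1) and G(0) = g. *)
Lemma orbit_interpolation_int s sinv f : is_Kalg_aut s sinv ->
  (forall j, nle (s (x j) - x j) (p%:R `^ (- c))) ->
  exists F : A, forall n : int, ev n%:~R F = zpow_fun s sinv n f.
Proof.
move=> [sD [sM [s1 [sZ [sK Ks]]]]] x_rho.
have [t HS] := Tate_tatelike Habs HT.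
have int1 := abs_int_le1 Habs.
have [F HF] := orbit_interpolation sD sM s1 sZ x_rho f.
exists F => -[n|n]; first exact: HF.
set g := zpow_fun _ _ _ _.
have gf : iter n.+1 s g = f.
  rewrite /g /=; elim: n {g} => [|n IH]; first by rewrite /= Ks.
  by rewrite iterSr /= Ks -[in RHS]IH.
have [G HG] := orbit_interpolation sD sM s1 sZ x_rho g.
have [a a0 Fa] := znle_bounded F; have [b b0 Gb] := znle_bounded G.
apply/eqP; rewrite -subr_eq0; apply/eqP; apply: (nle_small_eq0 Habs HS) => e e0.
have [j Hj] := inv_pow_small pr_p (divr_gt0 e0 (addr_gt0 a0 b0)).
(* [n.+1] keeps the subtraction [p ^ k - n.+1] from truncating; [j] gives the precision. *)
pose k := (maxn j n.+1); have le_nk : (n.+1 <= p ^ k)%N.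
  apply: leq_trans (leq_maxr j n.+1) _; apply: ltnW; exact: ltn_expl (prime_gt1 pr_p).
have dp : abs (p ^ k)%N%:R <= p%:R ^- j.
  have dv : ((p ^ j)%N %| (p ^ k)%N%:Z)%Z by rewrite dvdzE /= dvdn_exp2l // leq_maxl.
  exact: (abs_dvd Habs abs_p dv).
have E : ev (p ^ k - n.+1)%N%:R F = ev (p ^ k)%N%:R G.
  by rewrite HF HG -{1}gf -iterD subnK.
have small r : r <= a + b -> p%:R ^- j * r <= e.
  move=> le_r; move: Hj; rewrite ltr_pdivlMr ?addr_gt0 // => /ltW; apply: le_trans.
  by apply: ler_wpM2l => //; rewrite invr_ge0 exprn_ge0 // ltW.
rewrite -[_ - g](subrKA (ev (p ^ k - n.+1)%N%:R F)); apply: (nleD Habs HS).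
  apply: nle_trans (ev_dist Hev (int1 _) (abs_nat_le1 Habs _) Fa).
  apply: le_trans (small a _); last by rewrite lerDl ltW.
  apply: ler_wpM2r; first exact: ltW.
  rewrite -(absN Habs) opprB natrB // NegzE mulrNz opprK subrK; exact: dp.
rewrite E; have <- : ev 0 G = g by have := HG 0%N.
apply: nle_trans (ev_dist Hev (abs_nat_le1 Habs _) (abs_nat_le1 Habs 0) Gb).
apply: le_trans (small b _); last by rewrite lerDr ltW.
apply: ler_wpM2r; first exact: ltW.
by rewrite subr0; exact: dp.
Qed.

(** Vanishing at the positive integers implies vanishing at 0, the limit of the p^j. One can then
    divide by z, and the quotient vanishes at the positive integers again, so all coefficients are
    0. The value of the quotient at 0 is not known beforehand, hence the restriction to [0 < j]. *)
Lemma eval_identity (h : A) : (forall n : nat, ev n%:R h = 0) -> h = 0.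
Proof.
have [t HS] := Tate_tatelike Habs HT.
have nat1 := abs_nat_le1 Habs.
pose Q (h : A) := forall j, (0 < j)%N -> ev j%:R h = 0.
have Q0 h' : Q h' -> ev 0%:R h' = 0.
  move=> Qh; have [r r0 hr] := znle_bounded h'.
  apply: (nle_small_eq0 Habs HS) => e e0.
  have [j Hj] := inv_pow_small pr_p (divr_gt0 e0 r0).
  have := ev_dist Hev (nat1 0) (nat1 (p ^ j)%N) hr.
  rewrite (Qh (p ^ j)%N) ?expn_gt0 ?prime_gt0 // subr0; apply: nle_trans.
  rewrite -(absN Habs) opprB mulr0n subr0.
  apply: le_trans (_ : p%:R ^- j * r <= _).
    apply: ler_wpM2r; first exact: ltW.
    exact: (abs_dvd Habs abs_p (n := (p ^ j)%N%:Z) (dvdzz _)).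
  by move: Hj; rewrite ltr_pdivlMr // => /ltW.
have QS h' : Q h' -> exists h1, h' = zlin 0 * h1 /\ Q h1.
  move=> Qh; have [|g [E _]] := ev_kernel Hev _ (Q0 h' Qh); first exact: nat1.
  exists g; split=> // j j0; have := Qh j j0; rewrite E rmorphM /= ev_lin // subr0.
  rewrite -scalerAl mul1r => /(congr1 (fun f => j%:R^-1 *: f)); rewrite scaler0 scalerA mulVf ?scale1r //.
  by apply: (char0 Habs pr_p abs_p (n := j)); rewrite -lt0n.
move=> Qh; have {}Qh : Q h by move=> j _.
apply: zext => k; rewrite zcoef0; elim: k h Qh => [|k IH] h /QS[h1 [-> Qh1]].
  by rewrite zcoef_linM sub0r scale0r oppr0.
by rewrite zcoef_linM scale0r subr0; apply: IH.
Qed.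
End AnalyticOrbits.

(** * Free resolutions *)

Section Resolutions.
Variable S : comNzRingType.

Lemma row_lift m n l (M : 'M[S]_(m, n)) (B : 'M[S]_(l, n)) :
  (forall i, exists w : 'rV[S]_l, row i M = w *m B) -> exists W : 'M[S]_(m, l), M = W *m B.
Proof.
move=> /choice[w Hw]; exists (\matrix_i w i); apply/row_matrixP => i.
by rewrite row_mul rowK Hw.
Qed.

Definition exact_at_all (r : nat -> nat) (D : forall k, 'M[S]_(r k.+1, r k)) :=
  forall k (v : 'rV[S]_(r k.+1)), v *m D k = 0 <-> exists w : 'rV[S]_(r k.+2), v = w *m D k.+1.

Section Exact.
Variables (r : nat -> nat) (D : forall k, 'M[S]_(r k.+1, r k)).
Hypothesis ex : exact_at_all D.

Lemma exact_complex k : D k.+1 *m D k = 0.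
Proof.
apply/row_matrixP => i; rewrite row_mul row0; apply/ex.
by exists (delta_mx 0 i); rewrite rowE.
Qed.

Lemma exact_lift k m (M : 'M[S]_(m, r k.+1)) : M *m D k = 0 -> exists W, M = W *m D k.+1.
Proof.
move=> M0; apply: row_lift => i; have [|w ->] := (ex (row i M)).1; last by exists w.
by rewrite -row_mul M0 row0.
Qed.
End Exact.

Section ChainMaps.
Variables (r r' : nat -> nat) (D : forall k, 'M[S]_(r k.+1, r k)) (D' : forall k, 'M[S]_(r' k.+1, r' k)).
Hypotheses (ex : exact_at_all D) (ex' : exact_at_all D').

Lemma chain_map_exists (a0 : 'M[S]_(r 0%N, r' 0%N)) : (exists W, D 0%N *m a0 = W *m D' 0%N) ->
  exists al : forall k, 'M[S]_(r k, r' k),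
    al 0%N = a0 /\ forall k, D k *m al k = al k.+1 *m D' k.
Proof.
move=> /cid[a1 Ha1].
have next k (a : 'M[S]_(r k, r' k)) (b : 'M[S]_(r k.+1, r' k.+1)) :
    D k *m a = b *m D' k -> exists c, D k.+1 *m b = c *m D' k.+1.
  by move=> E; apply: exact_lift => //; rewrite -mulmxA -E mulmxA (exact_complex ex) mul0mx.
(* Each stage stores two consecutive maps with their commuting square, which is what choosing the
   next map requires. *)
pose T k := {ab : 'M[S]_(r k, r' k) * 'M[S]_(r k.+1, r' k.+1) | D k *m ab.1 = ab.2 *m D' k}.
pose F := fix F k : T k := match k with
  | 0%N => exist _ (a0, a1) Ha1
  | k'.+1 => let ab := F k' in let c := cid (next k' (sval ab).1 (sval ab).2 (svalP ab)) in
      exist _ ((sval ab).2, sval c) (svalP c)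
  end.
by exists (fun k => (sval (F k)).1); split=> // k; exact: (svalP (F k)).
Qed.

Lemma null_homotopy (ga : forall k, 'M[S]_(r k, r k)) : ga 0%N = 0 ->
  (forall k, D k *m ga k = ga k.+1 *m D k) ->
  forall k, exists s t, ga k.+1 = s *m D k.+1 + D k *m t.
Proof.
move=> ga0 gaD; elim=> [|k [s [t E]]].
  have [|s ->] := @exact_lift r D ex 0%N _ (ga 1%N); first by rewrite -gaD ga0 mulmx0.
  by exists s, 0; rewrite mulmx0 addr0.
have [|s' Es'] := @exact_lift r D ex k.+1 _ (ga k.+2 - D k.+1 *m s).
  by rewrite mulmxBl -gaD -mulmxA -mulmxBr E addrC addKr mulmxA (exact_complex ex) mul0mx.
by exists s', s; rewrite -Es' subrK.
Qed.
End ChainMaps.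

(** The ranks in degree 0 of two resolutions equal [e] only propositionally, so the identity of S^e
    is supplied as a pair of rectangular matrices. *)
Lemma cast_bridge m m' e (h : m = e) (h' : m' = e) : exists (a : 'M[S]_(m, m')) (b : 'M[S]_(m', m)),
  [/\ a *m b = 1%:M, forall w : 'rV[S]_m, castmx (erefl, h') (w *m a) = castmx (erefl, h) w &
      forall w : 'rV[S]_m', castmx (erefl, h) (w *m b) = castmx (erefl, h') w].
Proof.
subst m m'; exists 1%:M, 1%:M; rewrite mulmx1.
by split=> // w; rewrite mulmx1.
Qed.

Section RowsIn.
Variables (f : nat) (V : 'rV[S]_f -> Prop).
Hypothesis HV : is_submodule V.

Lemma rows_inD m (X Y : 'M[S]_(m, f)) : rows_in V X -> rows_in V Y -> rows_in V (X + Y).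
Proof. by case: HV => _ VD _ HX HY j; rewrite raddfD; exact: VD (HX j) (HY j). Qed.

Lemma rows_inM m n (B : 'M[S]_(m, n)) (X : 'M[S]_(n, f)) : rows_in V X -> rows_in V (B *m X).
Proof.
case: HV => V0 VD VZ HX j; rewrite row_mul mulmx_sum_row.
by elim/big_ind: _ => // i _; exact: VZ (HX i).
Qed.

Lemma rows_inN m (X : 'M[S]_(m, f)) : rows_in V X -> rows_in V (- X).
Proof. by move=> HX; rewrite -[- X]mul1mx mulmxN -mulNmx; apply: rows_inM. Qed.
End RowsIn.

Section Comparison.
Variables (e : nat) (U : 'rV[S]_e -> Prop) (f : nat) (V : 'rV[S]_f -> Prop).
Hypothesis HV : is_submodule V.

Lemma resolution_map r r' (D : forall k, 'M[S]_(r k.+1, r k)) (D' : forall k, 'M[S]_(r' k.+1, r' k))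
  (h : r 0%N = e) (h' : r' 0%N = e) (a : 'M[S]_(r 0%N, r' 0%N)) :
  (forall v : 'rV[S]_e, U v <-> exists w : 'rV[S]_(r 1%N), v = castmx (erefl, h) (w *m D 0%N)) ->
  (forall v : 'rV[S]_e, U v <-> exists w : 'rV[S]_(r' 1%N), v = castmx (erefl, h') (w *m D' 0%N)) ->
  (forall w : 'rV[S]_(r 0%N), castmx (erefl, h') (w *m a) = castmx (erefl, h) w) ->
  exists W, D 0%N *m a = W *m D' 0%N.
Proof.
move=> HU HU' Ha; apply: row_lift => i.
have [|w Hw] := (HU' (castmx (erefl, h) (row i (D 0%N)))).1.
  by apply/HU; exists (delta_mx 0 i); rewrite rowE.
exists w; rewrite row_mul; apply: (can_inj (castmxK (erefl 1%N) h')).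
by rewrite Ha.
Qed.

(** The composite of the comparison maps [al] and [be] is homotopic to the identity: up to a
    boundary and rows in [V], a cycle is the image under [be] of its image under [al], which is a
    boundary by assumption. *)
Lemma tor_comparison r r' (D : forall k, 'M[S]_(r k.+1, r k)) (D' : forall k, 'M[S]_(r' k.+1, r' k)) k :
  free_resolution U D -> free_resolution U D' ->
  (forall X : 'M_(r' k.+1, f), tor_cycle V D' X -> tor_boundary V D' X) ->
  forall X : 'M_(r k.+1, f), tor_cycle V D X -> tor_boundary V D X.
Proof.
move=> [h [HU ex]] [h' [HU' ex']] bd X cX.
have [a0 [b0 [ab1 Ha Hb]]] := cast_bridge h h'.
have [al [al0 Hal]] := chain_map_exists ex ex' (resolution_map HU HU' Ha).
have [be [be0 Hbe]] := chain_map_exists ex' ex (resolution_map HU' HU Hb).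
have [||s [t Est]] := null_homotopy ex (ga := fun k => al k *m be k - 1%:M) _ _ k.
- by rewrite al0 be0 ab1 subrr.
- by move=> l; rewrite mulmxBr mulmxBl mulmx1 mul1mx mulmxA Hal -!mulmxA Hbe.
have [|Y HY] := bd ((al k.+1)^T *m X).
  rewrite /= mulmxA -trmx_mul -Hal trmx_mul -mulmxA; exact: rows_inM.
exists ((be k.+2)^T *m Y - s^T *m X).
have -> : X - (D k.+1)^T *m ((be k.+2)^T *m Y - s^T *m X) =
    (be k.+1)^T *m ((al k.+1)^T *m X - (D' k.+1)^T *m Y) - t^T *m ((D k)^T *m X).
  have rearr (M : zmodType) (z u v w y : M) : z = u - v - w -> z - (y - v) = u - y - w.
    by move=> ->; rewrite opprB -[LHS]addrA [X in _ + X = _]addrCA [LHS]addrA subrK [LHS]addrA [LHS]addrAC.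
  have E1 : X = (be k.+1)^T *m ((al k.+1)^T *m X) - (D k.+1)^T *m (s^T *m X) - t^T *m ((D k)^T *m X).
    have := congr1 trmx Est; rewrite !linearB linearD /= !trmx_mul trmx1 => /eqP.
    rewrite subr_eq => /eqP E; rewrite !mulmxA E mulmxDl mulmxDl mul1mx.
    by rewrite -addrA -opprD [_ + X]addrC addrK.
  rewrite !mulmxBr [(D k.+1)^T *m ((be k.+2)^T *m Y)]mulmxA -trmx_mul -Hbe trmx_mul -mulmxA.
  exact: rearr.
apply: rows_inD => //; first exact: rows_inM.
by apply: rows_inN => //; apply: rows_inM.
Qed.
End Comparison.

Section BaseChange.
Variables (phi psi : {rmorphism S -> S}).
Hypotheses (phiK : cancel phi psi) (psiK : cancel psi phi).
Variables (e : nat) (U : 'rV[S]_e -> Prop).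

Lemma map_mxK m n (M : 'M[S]_(m, n)) : map_mx psi (map_mx phi M) = M.
Proof. by apply/matrixP => i j; rewrite !mxE phiK. Qed.
Lemma map_mxVK m n (M : 'M[S]_(m, n)) : map_mx phi (map_mx psi M) = M.
Proof. by apply/matrixP => i j; rewrite !mxE psiK. Qed.

Lemma basechange_subK : basechange_sub psi (basechange_sub phi U) = U.
Proof.
apply: funext => v; apply: propext; split=> [[_ [u Uu ->] ->]|Uv]; first by rewrite map_mxK.
by exists (map_mx phi v); [exists v|rewrite map_mxK].
Qed.

Lemma resolution_basechange r (D : forall k, 'M[S]_(r k.+1, r k)) :
  free_resolution U D -> free_resolution (basechange_sub phi U) (fun k => map_mx phi (D k)).
Proof.
move=> [h [HU ex]]; exists h; split=> [v|k v].
  split=> [[u /HU[w ->] ->]|[w ->]].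
    by exists (map_mx phi w); rewrite map_castmx map_mxM.
  exists (castmx (erefl, h) (map_mx psi w *m D 0%N)); first by apply/HU; exists (map_mx psi w).
  by rewrite map_castmx map_mxM map_mxVK.
split=> [v0|[w ->]].
  have [|w Hw] := (ex k (map_mx psi v)).1.
    by rewrite -[D k]map_mxK -map_mxM v0 map_mx0.
  by exists (map_mx phi w); rewrite -map_mxM -Hw map_mxVK.
have /(congr1 (map_mx phi)) : (map_mx psi w *m D k.+1) *m D k = 0 by apply/ex; exists (map_mx psi w).
by rewrite !map_mxM map_mxVK map_mx0.
Qed.

(** Replaces the existential over resolutions in [Tor_nonzero] by one fixed resolution of [U],
    transported along the automorphism; only its matrices then vary with n. *)
Lemma Tor_nonzero_basechange r (D : forall k, 'M[S]_(r k.+1, r k)) f (V : 'rV[S]_f -> Prop) k :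
  is_submodule V -> free_resolution U D ->
  (Tor_nonzero k.+1 (basechange_sub phi U) V <->
   exists X : 'M_(r k.+1, f), rows_in V (map_mx phi (D k)^T *m X) /\
     ~ exists Y : 'M_(r k.+2, f), rows_in V (X - map_mx phi (D k.+1)^T *m Y)).
Proof.
move=> HV res; have res' := resolution_basechange res.
split=> [[r' [D' [resD' [X [cX nbX]]]]]|[X [cX nbX]]]; last first.
  exists r, (fun k => map_mx phi (D k)); split=> //; exists X; split; first by rewrite /= map_trmx.
  by rewrite /tor_boundary map_trmx.
apply: contrapT => none; apply: nbX; apply: (tor_comparison HV resD' res' _ cX) => X' cX'.
apply: contrapT => nbX'; apply: none; exists X'; split; first by rewrite -map_trmx.
by move=> [Y HY]; apply: nbX'; exists Y; rewrite map_trmx.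
Qed.
End BaseChange.
End Resolutions.

(** * Integer powers of an algebra automorphism *)

Section Automorphisms.
Variables (K : fieldType) (S : comAlgType K).

Lemma Kalg_aut_sym (s sinv : S -> S) : is_Kalg_aut s sinv -> is_Kalg_aut sinv s.
Proof.
move=> [sD [sM [s1 [sZ [sK Ks]]]]]; have inj := can_inj sK.
do 4?split=> //.
- by move=> f g; apply: inj; rewrite sD !Ks.
- by move=> f g; apply: inj; rewrite sM !Ks.
- by apply: inj; rewrite s1 Ks.
- by move=> a f; apply: inj; rewrite sZ !Ks.
Qed.

Lemma Kalg_aut_iter (s sinv : S -> S) n : is_Kalg_aut s sinv -> is_Kalg_aut (iter n s) (iter n sinv).
Proof.
move=> H; elim: n => [|n [iD [iM [i1 [iZ [iK Ki]]]]]]; first by do 5!split=> //.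
have [sD [sM [s1 [sZ [sK Ks]]]]] := H.
do 5?split=> //=.
- by move=> f g; rewrite iD sD.
- by move=> f g; rewrite iM sM.
- by rewrite i1 s1.
- by move=> a f; rewrite iZ sZ.
- by move=> f; rewrite -[LHS]/(iter n.+1 sinv (s (iter n s f))) iterSr sK iK.
- by move=> f; rewrite -[LHS]/(iter n.+1 s (sinv (iter n sinv f))) iterSr Ks Ki.
Qed.

Lemma zpow_fun_rmorphisms (s sinv : S -> S) n : is_Kalg_aut s sinv ->
  exists phi psi : {rmorphism S -> S},
    [/\ (phi : S -> S) = zpow_fun s sinv n, cancel phi psi & cancel psi phi].
Proof.
have rm (t tinv : S -> S) : is_Kalg_aut t tinv -> exists phi : {rmorphism S -> S}, (phi : S -> S) = t.
  move=> [tD [tM [t1 [tZ _]]]].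
  have tB : zmod_morphism t by move=> a b; rewrite tD -scaleN1r tZ scaleN1r.
  have tm : monoid_morphism t by [].
  pose m1 := GRing.isZmodMorphism.Build S S t tB.
  pose m2 := GRing.isMonoidMorphism.Build S S t tm.
  by exists (HB.pack t m1 m2 : {rmorphism S -> S}).
move=> H; have [t Ht] : exists t, is_Kalg_aut (zpow_fun s sinv n) t.
  case: n => n; first by exists (iter n sinv); apply: Kalg_aut_iter.
  by exists (iter n.+1 s); apply: Kalg_aut_iter; apply: Kalg_aut_sym.
have [phi E1] := rm _ _ Ht; have [psi E2] := rm _ _ (Kalg_aut_sym Ht).
by exists phi, psi; rewrite E1 E2; have [_ [_ [_ [_ []]]]] := Ht.
Qed.
End Automorphisms.

(** * Homology of the family *)

Lemma finitely_generated (R : realType) (K : fieldType) (abs : K -> R) (Habs : nonarch_complete_abs abs)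
    (I : finType) (A : comNzRingType) (cf : {ffun I -> nat} -> A -> K) term
    (HA : tatelike abs cf term) m n (U : 'M[A]_(m, n) -> Prop) : submodule U ->
  exists (k : nat) (g : 'I_k -> 'M[A]_(m, n)), (forall j, U (g j)) /\
    forall X, U X -> exists h : 'I_k -> A, X = \sum_j h j *: g j.
Proof.
move=> HU; have [k [g [Ug Hg]]] := bounded_division Habs HA HU.
exists k, g; split=> // X UX.
have /choice[b Hb] (ij : 'I_m * 'I_n) : exists r, 0 < r /\ nle abs cf (X ij.1 ij.2) r.
  by have [r] := nle_bounded Habs HA (X ij.1 ij.2); exists r.
have b0 ij : 0 <= b ij by apply: ltW; case: (Hb ij).
have [||h [_ E]] := Hg X (1 + \sum_ij b ij) _ UX.
- by apply: ltr_pwDl => //; apply: sumr_ge0.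
- move=> i j; have [_] := Hb (i, j); apply: nle_trans.
  by rewrite (bigD1 (i, j)) //= addrCA lerDl addr_ge0 // sumr_ge0.
by exists h.
Qed.

Section Family.
Variables (R : realType) (p : nat) (K : fieldType) (abs : K -> R).
Hypotheses (pr_p : prime p) (Habs : nonarch_complete_abs abs) (abs_p : abs p%:R = (p%:R)^-1).
Variables (d : nat) (S : comAlgType K) (x : 'I_d -> S) (coef : mon d -> S -> K).
Hypothesis HT : is_Tate_algebra abs x coef.
Local Notation A := (zseries Habs HT).
Local Notation zC := (zC Habs HT).
Local Notation zlin := (zlin Habs HT).
Variable ev : K -> {rmorphism A -> S}.
Hypothesis Hev : is_evaluation ev.

Let int1 n : abs n%:~R <= 1. Proof. exact: abs_int_le1. Qed.

Lemma mx_ev_decomp e m n (M : 'M[A]_(m, n)) : abs e <= 1 ->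
  exists Q, M = map_mx zC (map_mx (ev e) M) + zlin e *: Q.
Proof.
move=> e1; have /choice[q Hq] (ij : 'I_m * 'I_n) : exists g, M ij.1 ij.2 = zC (ev e (M ij.1 ij.2)) + zlin e * g.
  by have [_ /(_ (M ij.1 ij.2))[g [E _]] _] := Hev e1; exists g.
exists (\matrix_(i, j) q (i, j)); apply/matrixP => i j; rewrite !mxE.
exact: (Hq (i, j)).
Qed.

Lemma mx_lin_reg e m n (M N : 'M[A]_(m, n)) : abs e <= 1 -> zlin e *: M = zlin e *: N -> M = N.
Proof.
move=> e1 /matrixP E; apply/matrixP => i j; have := E i j; rewrite !mxE; exact: zlin_reg.
Qed.

Lemma map_ev_zC e m n (M : 'M[S]_(m, n)) : abs e <= 1 -> map_mx (ev e) (map_mx zC M) = M.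
Proof. by move=> e1; apply/matrixP => i j; rewrite !mxE evC. Qed.

Lemma map_ev_lin e m n (M : 'M[A]_(m, n)) : abs e <= 1 -> map_mx (ev e) (zlin e *: M) = 0.
Proof. by move=> e1; rewrite map_mxZ ev_lin0 // scale0r. Qed.

(* The elements killed modulo [W] by some product of factors [z - j] form a
   finitely generated module, so a single product kills them all. *)
Lemma almost_regular m n (W : 'M[A]_(m, n) -> Prop) : submodule W ->
  exists E : seq int, forall k : int, k \notin E -> forall y, W (zlin k%:~R *: y) -> W y.
Proof.
move=> HW; have [W0 WD WZ] := HW.
pose pi (s : seq int) : A := \prod_(j <- s) zlin j%:~R.
have [t' HZ] := zseries_tatelike Habs HT.
have [|k [g [Ug Hg]]] := finitely_generated Habs HZ (U := fun y => exists s, W (pi s *: y)).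
  split.
  - by exists [::]; rewrite scaler0.
  - move=> u v [s Hs] [s' Hs']; exists (s ++ s'); rewrite /pi big_cat scalerDr /=; apply: WD.
      by rewrite mulrC -scalerA; apply: WZ.
    by rewrite -scalerA; apply: WZ.
  - by move=> a u [s Hs]; exists s; rewrite scalerA mulrC -scalerA; apply: WZ.
have /choice[s Hs] := Ug.
pose E := flatten [seq s j | j <- enum 'I_k].
exists E => l lE y Wy.
have [|h Eh] := Hg y; first by exists [:: l]; rewrite /pi big_seq1.
have WE : W (pi E *: y).
  rewrite Eh scaler_sumr; apply: submod_sum => // j _.
  rewrite scalerA mulrC -scalerA; apply: (WZ).
  rewrite /pi big_flatten big_map /= big_enum (bigD1 j) //= mulrC -scalerA.
  exact: WZ (Hs j).
(* The value of [pi E] at [l], nonzero since [l] is not in [E]. Modulo z - l the killing product is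
   therefore an invertible constant, so [y] itself lies in [W]. *)
pose kap : K := \prod_(j <- E) (l%:~R - j%:~R).
have kap0 : kap != 0.
  rewrite /kap prodf_seq_neq0; apply/allP => j jE /=; rewrite -intrB.
  apply: (char0 Habs pr_p abs_p); rewrite subr_eq0; apply: contraNneq lE => ->; exact: jE.
have evE : ev l%:~R (pi E) = kap%:A.
  rewrite rmorph_prod /kap; elim: E {lE WE kap kap0} => [|j E IH]; first by rewrite !big_nil scale1r.
  by rewrite !big_cons IH ev_lin // -scalerAl mul1r scalerA.
have [_ /(_ (pi E))[q [Eq _]] _] := Hev (int1 l).
have Wk : W (zC kap%:A *: y).
  have -> : zC kap%:A *: y = pi E *: y - q *: (zlin l%:~R *: y).
    by rewrite scalerA -scalerBl {1}Eq evE [q * _]mulrC addrK.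
  by apply: submodB => //; apply: WZ.
have := WZ (zC kap^-1%:A) _ Wk; rewrite scalerA -rmorphM /=.
by rewrite -scalerAl mul1r scalerA mulVf // scale1r rmorph1 scale1r.
Qed.

Section Homology.
Variables (b m l g f : nat) (P : 'M[A]_(b, m)) (Q : 'M[A]_(m, l)) (G : 'M[S]_(g, f)).
Hypothesis PQ : P *m Q = 0.
Let GA := map_mx zC G.

Definition zcycle (X : 'M[A]_(m, f)) := exists H, P *m X = H *m GA.
Definition zboundary (X : 'M[A]_(m, f)) := exists Y H, X = Q *m Y + H *m GA.
Definition cycle_at (n : int) (X : 'M[S]_(m, f)) := exists H, map_mx (ev n%:~R) P *m X = H *m G.
Definition boundary_at (n : int) (X : 'M[S]_(m, f)) :=
  exists Y H, X = map_mx (ev n%:~R) Q *m Y + H *m G.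

(** The relations [GA] have constant coefficients: evaluating at [n] shows that [H] at [n] is a
    syzygy of [G], so only the part of [H] divisible by z - n contributes. *)
Let GA_regular k (n : int) (y : 'M[A]_(k, f)) H :
  zlin n%:~R *: y = H *m GA -> exists H', y = H' *m GA.
Proof.
move=> E; have [q Eq] := mx_ev_decomp H (int1 n); exists q.
have := congr1 (map_mx (ev n%:~R)) E; rewrite map_ev_lin // map_mxM map_ev_zC // => E0.
apply: (mx_lin_reg (int1 n)); rewrite E {1}Eq mulmxDl /GA -map_mxM -E0 map_mx0 add0r.
by rewrite scalemxAl.
Qed.

Let zcycle_submod : submodule zcycle.
Proof.
split; first by exists 0; rewrite mulmx0 mul0mx.
  by move=> u v [H E] [H' E']; exists (H + H'); rewrite mulmxDr mulmxDl E E'.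
by move=> a u [H E]; exists (a *: H); rewrite -scalemxAr E scalemxAl.
Qed.

Let zboundary_submod : submodule zboundary.
Proof.
split; first by exists 0, 0; rewrite mulmx0 mul0mx addr0.
  move=> u v [Y [H ->]] [Y' [H' ->]]; exists (Y + Y'), (H + H').
  by rewrite mulmxDr mulmxDl addrACA.
move=> a u [Y [H ->]]; exists (a *: Y), (a *: H).
by rewrite -scalemxAr -scalemxAl scalerDr.
Qed.

Let zboundary_cycle X : zboundary X -> zcycle X.
Proof.
move=> [Y [H ->]]; exists (P *m H); by rewrite mulmxDr mulmxA PQ mul0mx add0r mulmxA.
Qed.

Let cokernel_submod : submodule (fun X => exists Y H, X = P *m Y + H *m GA).
Proof.
split; first by exists 0, 0; rewrite mulmx0 mul0mx addr0.
  move=> u v [Y [H ->]] [Y' [H' ->]]; exists (Y + Y'), (H + H').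
  by rewrite mulmxDr mulmxDl addrACA.
move=> a u [Y [H ->]]; exists (a *: Y), (a *: H).
by rewrite -scalemxAr -scalemxAl scalerDr.
Qed.

Definition annihilator (a : A) := forall X, zcycle X -> zboundary (a *: X).

(* The annihilator of the homology module detects the vanishing of its fibre
   (determinant trick), and that fibre is the homology of the fibre complex
   wherever the cokernel of P has no (z - n)-torsion. *)
Lemma exact_at_iff (n : int) :
  (forall y, (exists Y H, zlin n%:~R *: y = P *m Y + H *m GA) -> exists Y H, y = P *m Y + H *m GA) ->
  (exists a, annihilator a /\ ev n%:~R a = 1) <-> forall X, cycle_at n X -> boundary_at n X.
Proof.
move=> reg; have n1 := int1 n; split=> [[a [Ia a1]] X [H E]|ex].
  (* The constant lift of [X] is a cycle only modulo z - n. By [reg] the defect is z - n times an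
     element [P *m Y] modulo [GA], and subtracting (z - n) [Y] yields a true cycle. *)
  have [q Eq] := mx_ev_decomp (P *m map_mx zC X - map_mx zC H *m GA) n1.
  rewrite raddfB /= !map_mxM !map_ev_zC // E subrr map_mx0 add0r in Eq.
  have [|Y [H' Ey]] := reg q.
    exists (map_mx zC X), (- map_mx zC H); by rewrite -Eq mulNmx.
  have cX1 : zcycle (map_mx zC X - zlin n%:~R *: Y).
    exists (map_mx zC H + zlin n%:~R *: H'); rewrite mulmxBr mulmxDl -scalemxAr -scalemxAl.
    have -> : P *m map_mx zC X = map_mx zC H *m GA + zlin n%:~R *: q by rewrite -Eq addrC subrK.
    by rewrite Ey scalerDr -addrA [zlin _ *: (P *m Y) + _]addrC addrK.
  have [Y' [H'' E']] := Ia _ cX1.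
  exists (map_mx (ev n%:~R) Y'), (map_mx (ev n%:~R) H'').
  have := congr1 (map_mx (ev n%:~R)) E'; rewrite map_mxZ a1 scale1r raddfB /= map_ev_lin // subr0.
  by rewrite map_ev_zC // raddfD /= !map_mxM map_ev_zC.
(* Exactness of the fibre gives T = (z - n) T: a cycle minus a lift of its boundary at [n] is
   divisible by z - n, and by [GA_regular] the quotient is a cycle. *)
have step X : zcycle X -> exists X' X'', [/\ zboundary X', zcycle X'' & X = X' + zlin n%:~R *: X''].
  move=> cX; have [H E] := cX.
  have [|Y [H' E']] := ex (map_mx (ev n%:~R) X).
    by exists (map_mx (ev n%:~R) H); rewrite -map_mxM E map_mxM map_ev_zC.
  pose X' := Q *m map_mx zC Y + map_mx zC H' *m GA.
  have bX' : zboundary X' by exists (map_mx zC Y), (map_mx zC H').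
  have [X'' E''] := mx_ev_decomp (X - X') n1.
  have ev0 : map_mx (ev n%:~R) (X - X') = 0.
    by rewrite raddfB /= raddfD /= !map_mxM !map_ev_zC // E' subrr.
  rewrite ev0 map_mx0 add0r in E''.
  exists X', X''; split=> //; last by rewrite -E'' addrC subrK.
  have [H2 E2] : zcycle (X - X') by apply: submodB => //; apply: zboundary_cycle.
  rewrite E'' -scalemxAr in E2; exact: GA_regular E2.
have [t' HZ] := zseries_tatelike Habs HT.
have [k [z [cz Hz]]] := finitely_generated Habs HZ zcycle_submod.
have /choice[w Hw] j : exists w : 'I_k -> A, zboundary (z j - zlin n%:~R *: \sum_i w i *: z i).
  have [X' [X'' [bX' cX'' E]]] := step (z j) (cz j); have [h Eh] := Hz X'' cX''.
  by exists h; rewrite -Eh E addrK.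
(* [N] kills the classes of the generators, so its determinant annihilates T; modulo z - n it is the
   identity matrix, so the determinant is 1 at [n]. *)
pose N : 'M[A]_k := 1%:M - zlin n%:~R *: \matrix_(j, i) w j i.
have bN j : zboundary (\sum_i N j i *: z i).
  have -> : \sum_i N j i *: z i = z j - zlin n%:~R *: \sum_i w j i *: z i.
    under eq_bigr do rewrite !mxE scalerBl -scalerA.
    rewrite sumrB scaler_sumr (bigD1 j) //= eqxx scale1r big1 ?addr0 // => i /negPf ne.
    by rewrite eq_sym ne scale0r.
  exact: Hw.
exists (\det N); split=> [X cX|].
  have [h ->] := Hz X cX; have [_ _ BZ] := zboundary_submod.
  rewrite scaler_sumr; apply: submod_sum => // i _.
  rewrite scalerA mulrC -scalerA; apply: (BZ).
  have -> : \det N *: z i = \sum_j (\adj N) i j *: \sum_i' N j i' *: z i'.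
    under eq_bigr do rewrite scaler_sumr.
    rewrite exchange_big /= (bigD1 i) //= [X in _ + X]big1 ?addr0 => [|i' ne].
      under eq_bigr do rewrite scalerA.
      rewrite -scaler_suml; congr (_ *: _).
      by have /matrixP/(_ i i) := mul_adj_mx N; rewrite !mxE eqxx mulr1n.
    under eq_bigr do rewrite scalerA.
    rewrite -scaler_suml; have /matrixP/(_ i i') := mul_adj_mx N.
    by rewrite !mxE eq_sym (negPf ne) mulr0n => ->; rewrite scale0r.
  by apply: submod_sum => // j _; apply: BZ.
rewrite -det_map_mx raddfB /= map_ev_lin // subr0 map_mx1; exact: det1.
Qed.

Lemma homology_nonzero_APs : exists r, ae_union_of_APs (p ^ r)
  (fun n => exists X, cycle_at n X /\ ~ boundary_at n X).
Proof.
have [E HE] := almost_regular cokernel_submod.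
pose Pr n := ~ exists a, annihilator a /\ ev n%:~R a = 1.
have [_ BD BZ] := zboundary_submod.
have I0 : annihilator 0 by move=> X _; rewrite scale0r; case: zboundary_submod.
have ID a a' : annihilator a -> annihilator a' -> annihilator (a + a').
  by move=> Ha Ha' X cX; rewrite scalerDl; apply: BD; [apply: Ha|apply: Ha'].
have IM a a' : annihilator a' -> annihilator (a * a').
  by move=> Ha X cX; rewrite -scalerA; apply: BZ; apply: Ha.
have [|r [As [E' HE']]] := ae_union_of_local Habs pr_p abs_p (P := Pr).
  move=> a a1; have [eta eta0 H] := local_dichotomy Hev I0 ID IM a1.
  exists eta => //; case: H => H; [right|left] => n na lt_na; first by apply; apply: H.
  exact: H.
exists r, As, (E ++ E') => n; rewrite mem_cat negb_or => /andP[nE nE'].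
rewrite -(HE' n nE') /Pr (exact_at_iff (HE n nE)); split=> [[X [cX nbX]] all|nall].
  exact: nbX (all X cX).
apply: contrapT => none; apply: nall => X cX; apply: contrapT => nbX.
by apply: none; exists X.
Qed.
End Homology.
End Family.

Lemma generator_matrix (R : realType) (K : fieldType) (abs : K -> R) (Habs : nonarch_complete_abs abs)
    d (S : comAlgType K) (x : 'I_d -> S) (coef : mon d -> S -> K) (HT : is_Tate_algebra abs x coef)
    f (V : 'rV[S]_f -> Prop) : is_submodule V ->
  exists g (G : 'M[S]_(g, f)), forall m (X : 'M[S]_(m, f)), rows_in V X <-> exists H, X = H *m G.
Proof.
move=> HV; have [t HS] := Tate_tatelike Habs HT.
have [g [z [Vz Hz]]] := finitely_generated Habs HS (HV : submodule V).
have GE (h : 'rV_g) : h *m (\matrix_j z j) = \sum_j h 0 j *: z j.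
  by rewrite mulmx_sum_row; apply: eq_bigr => j _; rewrite rowK.
exists g, (\matrix_j z j) => m X; split=> [VX|[H ->]].
  apply: row_lift => i; have [h ->] := Hz _ (VX i); exists (\row_j h j).
  by rewrite GE; apply: eq_bigr => j _; rewrite mxE.
by apply: rows_inM => // j; rewrite rowK.
Qed.

Theorem theorem1p2 (R : realType) (p : nat) (K : fieldType) (absK : K -> R)
    (d : nat) (S : comAlgType K) (x : 'I_d -> S) (coef : mon d -> S -> K)
    (sigma sigmainv : S -> S) (c : R)
    (e : nat) (U : 'rV[S]_e -> Prop) (f : nat) (V : 'rV[S]_f -> Prop) (i : nat) :
  prime p ->
  nonarch_complete_abs absK ->
  absK (p%:R) = (p%:R)^-1 ->
  is_Tate_algebra absK x coef ->
  is_Kalg_aut sigma sigmainv ->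
  1 / (p%:R - 1) < c ->
  (forall j : 'I_d, exists2 rr : R,
      is_gauss_norm absK coef (sigma (x j) - x j) rr & rr < (p%:R : R) `^ (- c)) ->
  is_submodule U -> is_submodule V ->
  (1 <= i)%N ->
  exists r : nat, ae_union_of_APs (p ^ r)
    (fun n : int => Tor_nonzero i (basechange_sub (zpow_fun sigma sigmainv n) U) V).
Proof.
move=> pr_p Habs abs_p HT Hs c_gt x_small HU HV; case: i => // k _.
have zp n := zpow_fun_rmorphisms n Hs.
(* If [U] has no resolution by finite free modules, neither has a base change of it, since one could
   be carried back along the inverse; [Tor_nonzero] then fails for all n and the union is empty. *)
have [[r [D res]]|nores] := EM (exists r D, @free_resolution S e U r D); last first.
  exists 0%N, [::], [::] => n _; split=> [[r [D [res _]]]|[]//].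
  have [phi [psi [Ephi phiK psiK]]] := zp n; case: nores.
  have := resolution_basechange psiK phiK res; rewrite -Ephi basechange_subK // => res'.
  by exists r, (fun k => map_mx psi (D k)).
have [ev Hev] := evaluation_exists Habs HT.
have x_rho j : nle absK coef (sigma (x j) - x j) (p%:R `^ (- c)).
  by have [rr [rr_le _] lt_rr] := x_small j; move=> al; apply: le_trans (rr_le al) (ltW lt_rr).
have /choice[F HF] g := orbit_interpolation_int pr_p abs_p Hev c_gt g Hs x_rho.
pose P := map_mx F (D k)^T; pose Q := map_mx F (D k.+1)^T.
have evF n a b (M : 'M[S]_(a, b)) : map_mx (ev n%:~R) (map_mx F M) = map_mx (zpow_fun sigma sigmainv n) M.
  by apply/matrixP => u v; rewrite !mxE HF.
(* [F] is chosen element by element and is not known to be multiplicative; the identity over A is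
   checked at every natural n, where it is the image under sigma^n of the relation between
   consecutive differentials. *)
have PQ : P *m Q = 0.
  apply/matrixP => u v; rewrite [RHS]mxE; apply: (eval_identity pr_p abs_p Hev) => n.
  have [phi [psi [Ephi _ _]]] := zp n.
  have : map_mx (ev n%:~R) (P *m Q) = 0.
    rewrite map_mxM !evF -Ephi -map_mxM -trmx_mul.
    by case: res => h [_ /exact_complex ->]; rewrite trmx0 map_mx0.
  by move/matrixP/(_ u v); rewrite !mxE.
have [g [G HG]] := generator_matrix Habs HT HV.
have [q [As [E HE]]] := homology_nonzero_APs pr_p abs_p Hev G PQ.
exists q, As, E => n nE; rewrite -(HE n nE).
have [phi [psi [Ephi phiK psiK]]] := zp n.
rewrite -Ephi (Tor_nonzero_basechange phiK psiK k HV res).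
have bd X : boundary_at ev Q G n X <-> exists Y, rows_in V (X - map_mx phi (D k.+1)^T *m Y).
  rewrite /boundary_at /Q evF -Ephi; split=> [[Y [H ->]]|[Y /HG[H E']]].
    by exists Y; apply/HG; exists H; rewrite addrC addKr.
  by exists Y, H; rewrite -E' addrC subrK.
have cy X : cycle_at ev P G n X <-> rows_in V (map_mx phi (D k)^T *m X).
  by rewrite /cycle_at /P evF -Ephi HG.
by split=> -[X [/cy cX nbX]]; exists X; split=> // /bd.
Qed.
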